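(* Let $\Lambda$ be a basic Artin algebra with Jacobson radical $J$, and let $e\in\Lambda$ be an idempotent such that the left $\Lambda$-module $\Lambda(1-e)/J(1-e)$ has finite projective dimension and $e\Lambda(1-e)$ has finite projective dimension as a left $e\Lambda e$-module. Then $\mathcal{P}^{<\infty}(\Lambda\text{-mod})$ is contravariantly finite in $\Lambda\text{-mod}$ if and only if $\mathcal{P}^{<\infty}(e\Lambda e\text{-mod})$ is contravariantly finite in $e\Lambda e\text{-mod}$. In more detail, the following two implications hold for every finitely generated left $\Lambda$-module $F\in\mathcal{F}$. (1) If $p:M\to F$ is a minimal right $\mathcal{P}^{<\infty}(\Lambda\text{-mod})$-approximation of $F$, then $p|_{eM}:eM\to eF$ is a minimal right $\mathcal{P}^{<\infty}(e\Lambda e\text{-mod})$-approximation of $eF$. (2) Suppose that $q:X\to eF$ is a minimal right $\mathcal{P}^{<\infty}(e\Lambda e\text{-mod})$-approximation of $eF$, and let $f$ be the composition $$\frac{\Lambda e\otimes_{e\Lambda e}X}{\Delta(\Lambda e\otimes_{e\Lambda e}X)}\ \overset{\overline{1\otimes q}}{\longrightarrow}\ \frac{\Lambda e\otimes_{e\Lambda e}eF}{\Delta(\Lambda e\otimes_{e\Lambda e}eF)}\ \overset{\overline{\epsilon}_F}{\longrightarrow}\ F,$$ where $\overline{\epsilon}_F$ is induced by the natural map $\epsilon_F:\Lambda e\otimes_{e\Lambda e}eF\to F$, $a\otimes x\mapsto ax$. Then any representative of the unique maximal element of the poset $\mathcal{E}_f$ of essential $\Delta$-extensions of $f$ is a minimal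 right $\mathcal{P}^{<\infty}(\Lambda\text{-mod})$-approximation of $F$.
   Context: For an Artin algebra $A$, $A\text{-mod}$ is the category of finitely generated left $A$-modules and $\mathcal{P}^{<\infty}(A\text{-mod})$ its full subcategory of modules of finite projective dimension. $A$ is basic if $A/J(A)$ is a product of division rings. A (right) $\mathcal{P}^{<\infty}(A\text{-mod})$-approximation of $M\in A\text{-mod}$ is a map $\phi:X\to M$ with $X\in\mathcal{P}^{<\infty}(A\text{-mod})$ through which every homomorphism from an object of $\mathcal{P}^{<\infty}(A\text{-mod})$ to $M$ factors; it is minimal if every endomorphism $u$ of $X$ with $\phi\circ u=\phi$ is an automorphism. $\mathcal{P}^{<\infty}(A\text{-mod})$ is contravariantly finite in $A\text{-mod}$ if every $M\in A\text{-mod}$ has such an approximation. For a left $\Lambda$-module $M$, $\Delta(M)=\{x\in M: e\Lambda x=0\}$. $\mathcal{T}$ is the class of left $\Lambda$-modules $X$ with $eX=0$ and $\mathcal{F}$ the class of left $\Lambda$-modules $F$ with $\Delta(F)=0$; $(\mathcal{T},\mathcal{F})$ is a hereditary torsion pair with torsion radical $\Delta$. Let $f:M\to Y$ be a morphism in $\Lambda\text{-mod}$. An eligible extension of $f$ is a pair $(L,g)$ where $L$ is an essential extension of $M$ with $L/M\in\mathcal{T}$ and $g\in\operatorname{Hom}_\Lambda(L,Y)$ satisfies $g|_M=f$. Two eligible pairs $(L,g)$, $(L',g')$ are isomorphic if there is an isomorphism $\psi:L\to L'$ with $g'\circ\psi=g$. An essential $\Delta$-extension of $f$ is an isomorphism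 class $[(L,g)]$ of eligible pairs. The set $\mathcal{E}_f$ of all essential $\Delta$-extensions of $f$ is partially ordered by $[(L,g)]\preceq[(L',g')]$ if there is a monomorphism $\psi:L\to L'$ with $g'\circ\psi=g$. If $M,Y\in\mathcal{F}$, then $\mathcal{E}_f$ has a maximum. *)

(* Defs.v *)
From HB Require Import structures.
From mathcomp Require Import all_boot all_algebra.
From mathcomp Require Import boolp.

Set Implicit Arguments.
Unset Strict Implicit.
Unset Printing Implicit Defensive.

Import GRing.Theory.
Local Open Scope ring_scope.
Local Open Scope quotient_scope.

(* Rings are [pzRingType]s, so that the zero ring is allowed: the corner ring
   eAe is the zero ring when e = 0.  A left A-module is an [lmodType A]; its
   submodules are the [submodClosed M] predicates, which are bool-valued but
   range over arbitrary submodules by classical logic. *)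

Section QuotientModule.
Variables (A : pzRingType) (M : lmodType A) (N : submodClosed M).

(* [submodClosed] does not record closure under opposites, which
   [Quotient.quot] requires. *)
Definition zmod_of_submod : {pred M} := [in N].
Fact zmod_of_submod_closed : zmod_closed zmod_of_submod.
Proof.
split=> [|x y xN yN]; first exact: (rpred0 N).
by rewrite -scaleN1r; apply: (rpredD (S := N)) => //; apply: rpredZ.
Qed.
HB.instance Definition _ :=
  GRing.isZmodClosed.Build M zmod_of_submod zmod_of_submod_closed.

Definition quotmod := Quotient.quot zmod_of_submod.

HB.instance Definition _ := GRing.Zmodule.on quotmod.

Definition quotpi (x : M) : quotmod := \pi_(Quotient.quot zmod_of_submod) x.

Lemma quotpiE x y : quotpi x = quotpi y <-> x - y \in N.
Proof.
split=> [/eqP|H]; first by rewrite /quotpi -Quotient.idealrBE.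
by apply/eqP; rewrite /quotpi -Quotient.idealrBE.
Qed.

Lemma quotpi_repr (u : quotmod) : quotpi (repr u) = u.
Proof. exact: reprK. Qed.

Lemma quotpiD x y : quotpi (x + y) = quotpi x + quotpi y.
Proof. exact: (raddfD (\pi_(Quotient.quot zmod_of_submod))). Qed.

Definition quotscale (a : A) (u : quotmod) : quotmod := quotpi (a *: repr u).

Lemma quotpiZ a x : quotpi (a *: x) = quotscale a (quotpi x).
Proof.
apply/quotpiE; rewrite -scalerBr; apply: rpredZ.
by apply/quotpiE; rewrite quotpi_repr.
Qed.

Fact quotscaleA a b u : quotscale a (quotscale b u) = quotscale (a * b) u.
Proof. by rewrite -(quotpi_repr u) -!quotpiZ scalerA. Qed.
Fact quotscale1 u : quotscale 1 u = u.
Proof. by rewrite -(quotpi_repr u) -quotpiZ scale1r. Qed.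
Fact quotscaleDr a u v : quotscale a (u + v) = quotscale a u + quotscale a v.
Proof.
rewrite -(quotpi_repr u) -(quotpi_repr v).
by rewrite -quotpiD -!quotpiZ scalerDr quotpiD.
Qed.
Fact quotscaleDl u a b : quotscale (a + b) u = quotscale a u + quotscale b u.
Proof. by rewrite -(quotpi_repr u) -!quotpiZ scalerDl quotpiD. Qed.

HB.instance Definition _ := GRing.Zmodule_isLmodule.Build A quotmod
  quotscaleA quotscale1 quotscaleDr quotscaleDl.

Fact quotpi_is_linear : linear quotpi.
Proof. by move=> a x y; rewrite quotpiD quotpiZ. Qed.
HB.instance Definition _ :=
  GRing.isLinear.Build A M quotmod *:%R quotpi quotpi_is_linear.

Variables (W : lmodType A) (f : {linear M -> W}).
Hypothesis fN : forall x, x \in N -> f x = 0.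

Definition quotlift & (forall x, x \in N -> f x = 0) : quotmod -> W :=
  fun u => f (repr u).

Lemma quotlift_pi x : quotlift fN (quotpi x) = f x.
Proof.
apply/eqP; rewrite -subr_eq0 -linearB; apply/eqP/fN.
by apply/quotpiE; rewrite quotpi_repr.
Qed.

Fact quotlift_is_linear : linear (quotlift fN).
Proof.
move=> a u v; rewrite -(quotpi_repr u) -(quotpi_repr v) -linearP.
by rewrite !quotlift_pi linearP.
Qed.
HB.instance Definition _ :=
  GRing.isLinear.Build A quotmod W *:%R (quotlift fN) quotlift_is_linear.

End QuotientModule.

Section Range.
Variables (A : pzRingType) (M L : lmodType A) (i : {linear M -> L}).

Definition lrange : {pred L} := fun y => `[< exists x, i x = y >].

Fact lrange_closed : submod_closed lrange.
Proof.
split=> [|a _ _ /asboolP[x <-] /asboolP[y <-]]; apply/asboolP.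
  by exists 0; rewrite linear0.
by exists (a *: x + y); rewrite linearP.
Qed.
HB.instance Definition _ := GRing.isSubmodClosed.Build A L lrange
  (GRing.submod_closed_semi lrange_closed).
End Range.

Definition finitely_generated (A : pzRingType) (M : lmodType A) : Prop :=
  exists s : seq M, forall x : M, exists c : 'I_(size s) -> A,
    x = \sum_(i < size s) c i *: s`_i.

Definition artinian (R : comPzRingType) : Prop :=
  forall I : nat -> submodClosed R^o,
    (forall n, {subset I n.+1 <= I n}) ->
    exists n, forall m, (n <= m)%N -> I m =i I n.

(* [algType R] would exclude the zero algebra, so the R-algebra structure is
   given by its structure map, a ring morphism from R to the centre of A. *)
Definition artin_algebra (A : pzRingType) : Prop :=
  exists (R : comPzRingType) (phi : {rmorphism R -> A}),
    [/\ artinian R,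
        forall r a, phi r * a = a * phi r
      & exists s : seq A, forall a : A, exists c : 'I_(size s) -> R,
          a = \sum_(i < size s) phi (c i) * s`_i].

Section Jacobson.
Variable A : pzRingType.

Definition maximal_left_ideal (I : submodClosed A^o) : Prop :=
  1 \notin I /\
  forall K : submodClosed A^o,
    {subset I <= K} -> 1 \notin K -> {subset K <= I}.

Definition jacobson : {pred A^o} := fun x =>
  `[< forall I : submodClosed A^o, maximal_left_ideal I -> x \in I >].

Fact jacobson_closed : submod_closed jacobson.
Proof.
split=> [|a x y /asboolP xJ /asboolP yJ]; apply/asboolP => I mI.
  exact: rpred0.
by apply: rpredD; [apply: rpredZ; apply: xJ|apply: yJ].
Qed.
HB.instance Definition _ := GRing.isSubmodClosed.Build A A^o jacobson
  (GRing.submod_closed_semi jacobson_closed).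

Section Colon.
Variables (I : submodClosed A^o) (a : A).
Definition colon : {pred A^o} := fun y : A^o => (y * a : A^o) \in I.
Fact colon_closed : submod_closed colon.
Proof.
split=> [|b x y xI yI]; rewrite unfold_in; first by rewrite mul0r rpred0.
by rewrite mulrDl -mulrA rpredD // (rpredZ b).
Qed.
HB.instance Definition _ := GRing.isSubmodClosed.Build A A^o colon
  (GRing.submod_closed_semi colon_closed).
End Colon.

Section Adjoin.
Variables (I : submodClosed A^o) (z : A).
Definition adjoin : {pred A^o} := fun y : A^o => `[< exists b : A, (y - b * z : A^o) \in I >].
Fact adjoin_closed : submod_closed adjoin.
Proof.
split=> [|b x y /asboolP[c xI] /asboolP[d yI]]; apply/asboolP.
  by exists 0; rewrite mul0r subr0 rpred0.
exists (b * c + d).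
have -> : b *: x + y - (b * c + d) * z =
    b *: (x - c * z : A^o) + (y - d * z : A^o) :> A^o.
  rewrite -![b *: _]/(b * _ : A) mulrBr mulrDl opprD mulrA.
  exact: (@addrACA A).
by rewrite rpredD // rpredZ.
Qed.
HB.instance Definition _ := GRing.isSubmodClosed.Build A A^o adjoin
  (GRing.submod_closed_semi adjoin_closed).
End Adjoin.

Lemma jacobson_mulr (x a : A) :
  (x : A^o) \in jacobson -> (x * a : A^o) \in jacobson.
Proof.
move=> /asboolP xJ; apply/asboolP => I [I1 maxI].
have [aI|aI] := boolP ((a : A^o) \in I); first exact: (rpredZ x).
suff: (x : A^o) \in colon I a by [].
apply: xJ; split; first by rewrite unfold_in mul1r.
move=> K sK K1 y yK; rewrite unfold_in; apply: contraR K1 => yaI.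
have adj1 : (1 : A^o) \in adjoin I (y * a).
  apply: contraR yaI => adj1; apply: (maxI _ _ adj1) => [t tI|].
    by apply/asboolP; exists 0; rewrite mul0r subr0.
  by apply/asboolP; exists 1; rewrite mul1r subrr rpred0.
have /asboolP[b bI] := adj1.
have : (1 - a * b * y : A^o) \in K.
  apply: sK; rewrite unfold_in mulrBl mul1r -[X in X - _]mulr1 -!mulrA -mulrBr.
  exact: (rpredZ a).
by move=> H; rewrite -(subrK (a * b * y) 1) rpredD // (rpredZ (a * b)).
Qed.

(* A / J(A) as a ring: J(A), an intersection of left ideals, is two-sided by
   [jacobson_mulr]. *)
Definition jquot := quotmod jacobson.
HB.instance Definition _ := GRing.Zmodule.on jquot.

Definition jpi (x : A) : jquot := quotpi jacobson x.
Definition jmul (u v : jquot) : jquot := jpi (repr u * repr v).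

Lemma jpi_repr (u : jquot) : jpi (repr u) = u.
Proof. exact: quotpi_repr. Qed.

Lemma jpiD x y : jpi (x + y) = jpi x + jpi y.
Proof. exact: quotpiD. Qed.

Lemma jpiM x y : jpi (x * y) = jmul (jpi x) (jpi y).
Proof.
set x' : A := repr (jpi x); set y' : A := repr (jpi y).
have xx' : (x - x' : A^o) \in jacobson.
  by apply/quotpiE; rewrite [RHS]jpi_repr.
have yy' : (y - y' : A^o) \in jacobson.
  by apply/quotpiE; rewrite [RHS]jpi_repr.
apply/quotpiE; rewrite -/x' -/y'.
rewrite (_ : _ - _ = x * (y - y') + (x - x') * y'); last first.
  by rewrite mulrBr mulrBl addrA subrK.
apply: (rpredD (V := A^o)); last exact: jacobson_mulr.
exact: (rpredZ x).
Qed.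

Fact jmulA : associative jmul.
Proof.
move=> u v w; rewrite -(jpi_repr u) -(jpi_repr v) -(jpi_repr w).
by rewrite -!jpiM mulrA.
Qed.
Fact jmul1l : left_id (jpi 1) jmul.
Proof. by move=> u; rewrite -(jpi_repr u) -jpiM mul1r. Qed.
Fact jmul1r : right_id (jpi 1) jmul.
Proof. by move=> u; rewrite -(jpi_repr u) -jpiM mulr1. Qed.
Fact jmulDl : left_distributive jmul +%R.
Proof.
move=> u v w; rewrite -(jpi_repr u) -(jpi_repr v) -(jpi_repr w).
by rewrite -jpiD -!jpiM mulrDl jpiD.
Qed.
Fact jmulDr : right_distributive jmul +%R.
Proof.
move=> u v w; rewrite -(jpi_repr u) -(jpi_repr v) -(jpi_repr w).
by rewrite -jpiD -!jpiM mulrDr jpiD.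
Qed.
HB.instance Definition _ := GRing.Zmodule_isPzRing.Build jquot
  jmulA jmul1l jmul1r jmulDl jmulDr.

End Jacobson.
Arguments jacobson : clear implicits.

Definition division_ring (D : nzRingType) : Prop :=
  forall x : D, x != 0 -> exists y : D, y * x = 1 /\ x * y = 1.

(* The family [phi] is a ring isomorphism from A / J(A) onto the product of the
   [D i]: the last two clauses are its injectivity and its surjectivity. *)
Definition basic (A : pzRingType) : Prop :=
  exists (n : nat) (D : 'I_n -> nzRingType)
         (phi : forall i, {rmorphism jquot A -> D i}),
    [/\ forall i, division_ring (D i),
        forall u, (forall i, phi i u = 0) -> u = 0
      & forall d : (forall i, D i), exists u, forall i, phi i u = d i].

Section Homological.
Variable A : pzRingType.

Definition projective (P : lmodType A) : Prop :=
  forall (M N : lmodType A) (g : {linear M -> N}) (f : {linear P -> N}),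
    (forall y, exists x, g x = y) ->
    exists h : {linear P -> M}, forall x, g (h x) = f x.

(* M has a projective resolution
   0 -> P n -> ... -> P 1 -> P 0 -> M -> 0. *)
Definition pdim_le (M : lmodType A) (n : nat) : Prop :=
  exists (P : nat -> lmodType A)
         (d : forall i, {linear P i.+1 -> P i}) (eps : {linear P 0%N -> M}),
    [/\ forall i, projective (P i),
        forall i, (n < i)%N -> forall x : P i, x = 0,
        forall y, exists x, eps x = y,
        forall x, eps x = 0 <-> exists y, d 0%N y = x
      & forall i x, d i x = 0 <-> exists y, d i.+1 y = x].

Definition finite_pdim (M : lmodType A) : Prop := exists n, pdim_le M n.

(* The objects of P^{<oo}(A-mod).  The modules of a projective resolution need
   not be finitely generated. *)
Definition Pfin (M : lmodType A) : Prop :=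
  finitely_generated M /\ finite_pdim M.

Definition Pfin_approximation (X M : lmodType A) (phi : {linear X -> M}) : Prop :=
  Pfin X /\
  forall (Y : lmodType A) (h : {linear Y -> M}), Pfin Y ->
    exists g : {linear Y -> X}, forall y, phi (g y) = h y.

Definition minimal_Pfin_approximation
    (X M : lmodType A) (phi : {linear X -> M}) : Prop :=
  Pfin_approximation phi /\
  forall u : {linear X -> X}, (forall x, phi (u x) = phi x) -> bijective u.

Definition Pfin_contravariantly_finite : Prop :=
  forall M : lmodType A, finitely_generated M ->
    exists (X : lmodType A) (phi : {linear X -> M}), Pfin_approximation phi.

End Homological.

Section LeftIdeal.
Variables (A : pzRingType) (e : A).

(* For e idempotent, A e = {x | x e = x}. *)
Record lideal := LIdeal { lideal_val :> A^o; _ : lideal_val * e == lideal_val }.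
HB.instance Definition _ := [isSub for lideal_val].
HB.instance Definition _ := [Choice of lideal by <:].

Fact lideal_closed : submod_closed (fun x : A^o => x * e == x).
Proof.
split=> [|a x y /eqP xe /eqP ye]; rewrite unfold_in; first by rewrite mul0r.
by rewrite mulrDl ye -mulrA xe.
Qed.
HB.instance Definition _ := GRing.SubChoice_isSubLmodule.Build A A^o
  (fun x : A^o => x * e == x) lideal (GRing.submod_closed_semi lideal_closed).

Lemma lidealP (x : lideal) : val x * e = val x.
Proof. exact/eqP/(valP x). Qed.

(* The submodule J(A) e of A e. *)
Definition jlideal : {pred lideal} := fun x =>
  `[< exists2 j : A, (j : A^o) \in jacobson A & val x = j * e >].

Fact jlideal_closed : submod_closed jlideal.
Proof.
split=> [|a x y /asboolP[j jJ xE] /asboolP[k kJ yE]]; apply/asboolP.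
  by exists 0; rewrite ?rpred0 // mul0r.
exists (a * j + k); first by rewrite rpredD // (rpredZ a).
by rewrite linearP /= xE yE mulrDl -mulrA.
Qed.
HB.instance Definition _ := GRing.isSubmodClosed.Build A lideal jlideal
  (GRing.submod_closed_semi jlideal_closed).

End LeftIdeal.
Arguments jlideal {A} e.

Section Corner.
Variables (A : pzRingType) (e : A) (he : e * e = e).

Record corner (idem : e * e = e) :=
  Corner { corner_val :> A; _ : e * corner_val * e == corner_val }.
Local Notation eAe := (corner he).
HB.instance Definition _ := [isSub for @corner_val he].
HB.instance Definition _ := [Choice of eAe by <:].

Fact corner_closed : zmod_closed (fun x : A => e * x * e == x).
Proof.
split=> [|x y /eqP xe /eqP ye]; rewrite unfold_in; first by rewrite mulr0 mul0r.
by rewrite mulrBr mulrBl xe ye.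
Qed.
HB.instance Definition _ := GRing.SubChoice_isSubZmodule.Build A
  (fun x : A => e * x * e == x) eAe corner_closed.

Lemma cornerP (x : eAe) : e * val x * e = val x.
Proof. exact/eqP/(valP x). Qed.
Lemma corner_mull (x : eAe) : e * val x = val x.
Proof. by rewrite -(cornerP x) !mulrA he. Qed.
Lemma corner_mulr (x : eAe) : val x * e = val x.
Proof. by rewrite -(cornerP x) -!mulrA he. Qed.

Fact corner1_subproof : e * e * e == e. Proof. by rewrite he he. Qed.
Definition corner1 : eAe := Corner he corner1_subproof.
Fact cornerM_subproof (x y : eAe) : e * (val x * val y) * e == val x * val y.
Proof. by rewrite mulrA corner_mull -mulrA corner_mulr. Qed.
Definition cornerM (x y : eAe) : eAe := Corner he (cornerM_subproof x y).

Fact cornerMA : associative cornerM.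
Proof. by move=> x y z; apply: val_inj; rewrite /= mulrA. Qed.
Fact cornerM1l : left_id corner1 cornerM.
Proof. by move=> x; apply: val_inj; rewrite /= corner_mull. Qed.
Fact cornerM1r : right_id corner1 cornerM.
Proof. by move=> x; apply: val_inj; rewrite /= corner_mulr. Qed.
Fact cornerMDl : left_distributive cornerM +%R.
Proof. by move=> x y z; apply: val_inj; rewrite /= mulrDl. Qed.
Fact cornerMDr : right_distributive cornerM +%R.
Proof. by move=> x y z; apply: val_inj; rewrite /= mulrDr. Qed.
HB.instance Definition _ := GRing.Zmodule_isPzRing.Build eAe
  cornerMA cornerM1l cornerM1r cornerMDl cornerMDr.

Section CornerModule.
Variable M : lmodType A.

(* For e idempotent, e M = {x | e x = x}. *)
Record cornermod (idem : e * e = e) :=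
  CornerMod { cornermod_val :> M; _ : e *: cornermod_val == cornermod_val }.
Local Notation eM := (cornermod he).
HB.instance Definition _ := [isSub for @cornermod_val he].
HB.instance Definition _ := [Choice of eM by <:].

Fact cornermod_closed : zmod_closed (fun x : M => e *: x == x).
Proof.
split=> [|x y /eqP xe /eqP ye]; rewrite unfold_in; first by rewrite scaler0.
by rewrite scalerBr xe ye.
Qed.
HB.instance Definition _ := GRing.SubChoice_isSubZmodule.Build M
  (fun x : M => e *: x == x) eM cornermod_closed.

Lemma cornermodP (x : eM) : e *: val x = val x.
Proof. exact/eqP/(valP x). Qed.

Fact cornermodZ_subproof (c : eAe) (x : eM) :
  e *: (val c *: val x) == val c *: val x.
Proof. by rewrite scalerA corner_mull. Qed.
Definition cornermodZ (c : eAe) (x : eM) : eM :=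
  CornerMod he (cornermodZ_subproof c x).

Fact cornermodZA a b x :
  cornermodZ a (cornermodZ b x) = cornermodZ (a * b) x.
Proof. by apply: val_inj; rewrite /= scalerA. Qed.
Fact cornermodZ1 x : cornermodZ 1 x = x.
Proof. by apply: val_inj; rewrite /= cornermodP. Qed.
Fact cornermodZDr a x y :
  cornermodZ a (x + y) = cornermodZ a x + cornermodZ a y.
Proof. by apply: val_inj; rewrite /= scalerDr. Qed.
Fact cornermodZDl x a b :
  cornermodZ (a + b) x = cornermodZ a x + cornermodZ b x.
Proof. by apply: val_inj; rewrite /= scalerDl. Qed.
HB.instance Definition _ := GRing.Zmodule_isLmodule.Build eAe eM
  cornermodZA cornermodZ1 cornermodZDr cornermodZDl.

End CornerModule.

Section CornerMap.
Variables (M N : lmodType A) (p : {linear M -> N}).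

Fact cornermap_subproof (x : cornermod M he) : e *: p (val x) == p (val x).
Proof. by rewrite -linearZ /= cornermodP. Qed.
Definition cornermap (x : cornermod M he) : cornermod N he :=
  CornerMod he (cornermap_subproof x).
Fact cornermap_is_linear : linear cornermap.
Proof. by move=> c x y; apply: val_inj; rewrite /= linearP. Qed.
HB.instance Definition _ := GRing.isLinear.Build eAe (cornermod M he)
  (cornermod N he) *:%R cornermap cornermap_is_linear.
End CornerMap.

End Corner.
Arguments cornermap {A e} he {M N} p x.

Section Tensor.
Variables (A : pzRingType) (e : A) (he : e * e = e).
Local Notation eAe := (corner he).
Local Notation Ae := (lideal e).

Fact lidealM_subproof (a : Ae) (c : eAe) :
  (lideal_val a * val c : A) * e == lideal_val a * val c.
Proof. by rewrite -mulrA corner_mulr. Qed.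
Definition lidealM (a : Ae) (c : eAe) : Ae := LIdeal (lidealM_subproof a c).

Section Construction.
Variable X : lmodType eAe.

(* Sequences of pairs are formal sums of elementary tensors; [tens_eq] is the
   congruence generated by the usual relations.  The resulting commutative
   monoid is already a group, with opposites induced by (a, x) |-> (- a, x), so
   it is the quotient of the free abelian group on Ae * X by these relations
   (universal property: [tensor_lift_tens], [tensor_ext]). *)
Inductive tens_eq : seq (Ae * X) -> seq (Ae * X) -> Prop :=
| tens_refl s : tens_eq s s
| tens_sym s t : tens_eq s t -> tens_eq t s
| tens_trans s t u : tens_eq s t -> tens_eq t u -> tens_eq s u
| tens_cat s s' t t' : tens_eq s s' -> tens_eq t t' -> tens_eq (s ++ t) (s' ++ t')
| tens_catC s t : tens_eq (s ++ t) (t ++ s)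
| tens_0l x : tens_eq [:: (0, x)] [::]
| tens_Dl a b x : tens_eq [:: (a + b, x)] [:: (a, x); (b, x)]
| tens_Dr a x y : tens_eq [:: (a, x + y)] [:: (a, x); (a, y)]
| tens_bal a c x : tens_eq [:: (lidealM a c, x)] [:: (a, c *: x)].

Definition tens_equiv : rel (seq (Ae * X)) := fun s t => `[< tens_eq s t >].

Fact tens_equiv_class : equiv_class_of tens_equiv.
Proof.
split=> [s|s t|s t u]; first by apply/asboolP; exact: tens_refl.
  by apply/asboolP/asboolP; exact: tens_sym.
by move=> /asboolP st /asboolP tu; apply/asboolP; exact: tens_trans st tu.
Qed.
Canonical tens_equiv_rel := EquivRelPack tens_equiv_class.
Canonical tens_encModRel := defaultEncModRel tens_equiv.

Definition tensor := {eq_quot tens_equiv}.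
HB.instance Definition _ := Choice.on tensor.

Definition tclass (s : seq (Ae * X)) : tensor := \pi_({eq_quot tens_equiv}) s.

Lemma tclassE s t : tclass s = tclass t <-> tens_eq s t.
Proof.
by split=> [/eqmodP/asboolP|st]; last by apply/eqmodP/asboolP.
Qed.

Lemma tclass_repr (t : tensor) : tclass (repr t) = t.
Proof. exact: reprK. Qed.

Lemma tens_repr s : tens_eq (repr (tclass s)) s.
Proof. by apply/tclassE; rewrite tclass_repr. Qed.

Definition tadd (t u : tensor) : tensor := tclass (repr t ++ repr u).
Definition topp (t : tensor) : tensor :=
  tclass [seq (- p.1, p.2) | p <- repr t].

Lemma tclass_cat s t : tclass (s ++ t) = tadd (tclass s) (tclass t).
Proof.
apply/tclassE/tens_sym/tens_cat; exact: tens_repr.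
Qed.

Lemma tens_mapl (h : Ae -> Ae) (h0 : h 0 = 0) (hD : {morph h : a b / a + b})
    (hM : forall a c, h (lidealM a c) = lidealM (h a) c) s t :
  tens_eq s t ->
  tens_eq [seq (h p.1, p.2) | p <- s] [seq (h p.1, p.2) | p <- t].
Proof.
elim=> /= *; rewrite ?map_cat ?h0 ?hD ?hM.
- exact: tens_refl.
- exact: tens_sym.
- by apply: tens_trans; eassumption.
- exact: tens_cat.
- exact: tens_catC.
- exact: tens_0l.
- exact: tens_Dl.
- exact: tens_Dr.
- exact: tens_bal.
Qed.

Fact taddA : associative tadd.
Proof.
move=> t u v; rewrite -(tclass_repr t) -(tclass_repr u) -(tclass_repr v).
by rewrite -!tclass_cat catA.
Qed.
Fact taddC : commutative tadd.
Proof. by move=> t u; apply/tclassE; exact: tens_catC. Qed.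
Fact tadd0 : left_id (tclass [::]) tadd.
Proof. by move=> t; rewrite -(tclass_repr t) -tclass_cat. Qed.
Lemma tens_oppK s : tens_eq ([seq (- p.1, p.2) | p <- s] ++ s) [::].
Proof.
elim: s => [|[a x] s IHs]; first exact: tens_refl.
rewrite /= -cat1s -[(a, x) :: s]cat1s.
apply: tens_trans (_ : tens_eq (([:: (- a, x)] ++ [:: (a, x)])
  ++ ([seq (- p.1, p.2) | p <- s] ++ s)) _).
  rewrite -catA; apply: tens_cat; first exact: tens_refl.
  by rewrite !catA; apply: tens_cat; [exact: tens_catC|exact: tens_refl].
rewrite -[[::] in X in tens_eq _ X]cats0; apply: tens_cat => //.
apply: tens_trans (tens_sym (tens_Dl _ _ _)) _.
by rewrite addNr; exact: tens_0l.
Qed.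
Fact taddN : left_inverse (tclass [::]) topp tadd.
Proof.
move=> t; rewrite -[t in X in tadd _ X]tclass_repr /topp -tclass_cat.
by apply/tclassE; exact: tens_oppK.
Qed.
HB.instance Definition _ := GRing.isZmodule.Build tensor taddA taddC tadd0 taddN.

Lemma tclassD s t : tclass (s ++ t) = tclass s + tclass t.
Proof. exact: tclass_cat. Qed.

Definition tscale (a : A) (t : tensor) : tensor :=
  tclass [seq (a *: p.1, p.2) | p <- repr t].

Lemma tscale_class a s :
  tscale a (tclass s) = tclass [seq (a *: p.1, p.2) | p <- s].
Proof.
apply/tclassE; apply: (@tens_mapl (fun b => a *: b)); last exact: tens_repr.
- exact: scaler0.
- exact: scalerDr.
- by move=> b c; apply: val_inj; rewrite /=; exact: (@mulrA A).
Qed.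

Fact tscaleA a b t : tscale a (tscale b t) = tscale (a * b) t.
Proof.
rewrite -(tclass_repr t) !tscale_class -map_comp.
by congr tclass; apply: eq_map => p /=; rewrite scalerA.
Qed.
Fact tscale1 t : tscale 1 t = t.
Proof.
rewrite -[RHS]tclass_repr; congr tclass.
by rewrite -[RHS]map_id; apply: eq_map => -[a x]; rewrite /= scale1r.
Qed.
Fact tscaleDr a t u : tscale a (t + u) = tscale a t + tscale a u.
Proof.
rewrite -(tclass_repr t) -(tclass_repr u).
by rewrite -tclassD !tscale_class map_cat tclassD.
Qed.
Fact tscaleDl t a b : tscale (a + b) t = tscale a t + tscale b t.
Proof.
rewrite -(tclass_repr t) !tscale_class.
elim: (repr t) => [|[c x] s IHs] /=; first by rewrite addr0.
rewrite -cat1s -[(a *: c, x) :: _]cat1s -[(b *: c, x) :: _]cat1s.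
rewrite !tclassD IHs addrACA; congr (_ + _).
by rewrite -tclassD scalerDl; apply/tclassE; exact: tens_Dl.
Qed.
HB.instance Definition _ := GRing.Zmodule_isLmodule.Build A tensor
  tscaleA tscale1 tscaleDr tscaleDl.

Definition tens (a : Ae) (x : X) : tensor := tclass [:: (a, x)].

Lemma tclass_cons a x s : tclass ((a, x) :: s) = tens a x + tclass s.
Proof. by rewrite -cat1s tclassD. Qed.

Lemma scale_tens b a x : b *: tens a x = tens (b *: a) x.
Proof. exact: tscale_class. Qed.

Record balanced (W : zmodType) (b : Ae -> X -> W) : Prop := Balanced {
  balancedDl : forall a a' x, b (a + a') x = b a x + b a' x;
  balancedDr : forall a x y, b a (x + y) = b a x + b a y;
  balancedM : forall a c x, b (lidealM a c) x = b a (c *: x) }.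

Lemma tens_balanced : balanced tens.
Proof.
split=> [a a' x|a x y|a c x]; rewrite -?tclassD; apply/tclassE;
  [exact: tens_Dl|exact: tens_Dr|exact: tens_bal].
Qed.

Definition tensor_lift (W : zmodType) (b : Ae -> X -> W) (t : tensor) : W :=
  \sum_(p <- repr t) b p.1 p.2.

Lemma tensor_lift_class (W : zmodType) (b : Ae -> X -> W) s :
  balanced b -> tensor_lift b (tclass s) = \sum_(p <- s) b p.1 p.2.
Proof.
case=> bDl bDr bM; rewrite /tensor_lift.
move: (repr (tclass s)) (tens_repr s) => r.
elim=> {r s} [s|s t _ IH|s t u _ IHs _ IHt|s s' t t' _ IHs _ IHt|
  s t|x|a a' x|a x y|a c x]; rewrite ?big_cat ?big_cons ?big_nil /= ?addr0 //.
- by rewrite IHs.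
- by rewrite IHs IHt.
- by rewrite addrC.
- by apply: (addIr (b 0 x)); rewrite -bDl !add0r.
Qed.

Lemma tensor_lift_tens (W : zmodType) (b : Ae -> X -> W) a x :
  balanced b -> tensor_lift b (tens a x) = b a x.
Proof. by move=> bb; rewrite tensor_lift_class // big_seq1. Qed.

Lemma tensor_liftD (W : zmodType) (b : Ae -> X -> W) t u :
  balanced b -> tensor_lift b (t + u) = tensor_lift b t + tensor_lift b u.
Proof.
move=> bb; rewrite -(tclass_repr t) -(tclass_repr u).
by rewrite -tclassD !tensor_lift_class // big_cat.
Qed.

Lemma tensor_ext (W : zmodType) (f g : tensor -> W) :
    f 0 = 0 -> g 0 = 0 ->
    {morph f : t u / t + u} -> {morph g : t u / t + u} ->
  (forall a x, f (tens a x) = g (tens a x)) -> f =1 g.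
Proof.
move=> f0 g0 fD gD fg t; rewrite -(tclass_repr t).
elim: (repr t) => [|[a x] s IHs]; first by rewrite f0 g0.
by rewrite tclass_cons fD gD fg IHs.
Qed.

Lemma tensor_lift_linear (W : lmodType A) (b : Ae -> X -> W) :
  balanced b -> (forall c a x, b (c *: a) x = c *: b a x) ->
  linear (tensor_lift b).
Proof.
move=> bb bZ c t u; rewrite tensor_liftD //; congr (_ + _).
rewrite -(tclass_repr t) [c *: _ in LHS]tscale_class !tensor_lift_class //.
by rewrite big_map scaler_sumr; apply: eq_bigr => p _; rewrite bZ.
Qed.

End Construction.

Section TensorMap.
Variables (X Y : lmodType eAe) (q : {linear X -> Y}).

Definition tensor_map : tensor X -> tensor Y :=
  tensor_lift (fun a x => tens a (q x)).

Fact tensor_map_balanced : balanced (fun a x => tens a (q x)).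
Proof.
have [bDl bDr bM] := tens_balanced Y.
by split=> *; rewrite ?bDl ?linearD ?bDr ?bM ?linearZ.
Qed.
Fact tensor_map_is_linear : linear tensor_map.
Proof.
by apply: tensor_lift_linear => [|*];
   [exact: tensor_map_balanced|rewrite scale_tens].
Qed.
HB.instance Definition _ := GRing.isLinear.Build A (tensor X) (tensor Y) *:%R
  tensor_map tensor_map_is_linear.
End TensorMap.

Section TensorCounit.
Variable F : lmodType A.

Definition tensor_eps : tensor (cornermod F he) -> F :=
  tensor_lift (fun a (x : cornermod F he) => (lideal_val a : A) *: val x).

Fact tensor_eps_balanced :
  balanced (fun (a : Ae) (x : cornermod F he) => (lideal_val a : A) *: val x).
Proof.
by split=> [a a' x|a x y|a c x]; rewrite ?scalerDl ?scalerDr //= scalerA.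
Qed.
Fact tensor_eps_is_linear : linear tensor_eps.
Proof.
apply: tensor_lift_linear => [|c a x]; first exact: tensor_eps_balanced.
by rewrite scalerA.
Qed.
HB.instance Definition _ := GRing.isLinear.Build A (tensor (cornermod F he)) F *:%R
  tensor_eps tensor_eps_is_linear.
End TensorCounit.

End Tensor.
Arguments tensor_eps {A e} he F t.

Section Torsion.
Variables (A : pzRingType) (e : A).

Definition Delta (M : lmodType A) : {pred M} :=
  fun x => `[< forall a : A, (e * a) *: x = 0 >].
Arguments Delta : clear implicits.

Section Closed.
Variable M : lmodType A.
Fact Delta_closed : submod_closed (Delta M).
Proof.
split=> [|b x y /asboolP xD /asboolP yD]; apply/asboolP => a.
  by rewrite scaler0.
by rewrite scalerDr scalerA -mulrA xD yD addr0.
Qed.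
HB.instance Definition _ := GRing.isSubmodClosed.Build A M (Delta M)
  (GRing.submod_closed_semi Delta_closed).
End Closed.

Definition torsion (M : lmodType A) : Prop := forall x : M, e *: x = 0.
Definition torsionfree (M : lmodType A) : Prop :=
  forall x : M, x \in Delta M -> x = 0.

Lemma Delta_linear (M N : lmodType A) (f : {linear M -> N}) x :
  x \in Delta M -> f x \in Delta N.
Proof.
by move=> /asboolP xD; apply/asboolP => a; rewrite -linearZ /= xD linear0.
Qed.

Section DeltaMap.
Variables (M N : lmodType A) (f : {linear M -> N}).
Fact Deltamap_subproof x :
  x \in Delta M -> (quotpi (Delta N) \o f) x = 0.
Proof.
move=> /(Delta_linear f) fx; rewrite -(linear0 (quotpi (Delta N))).
by apply/quotpiE; rewrite subr0.
Qed.
Definition Deltamap : {linear quotmod (Delta M) -> quotmod (Delta N)} :=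
  quotlift Deltamap_subproof.
End DeltaMap.

Section DeltaLift.
Variables (M F : lmodType A) (f : {linear M -> F}) (hF : torsionfree F).
Fact Deltalift_subproof x : x \in Delta M -> f x = 0.
Proof. by move=> /(Delta_linear f); exact: hF. Qed.
Definition Deltalift : {linear quotmod (Delta M) -> F} :=
  quotlift Deltalift_subproof.
End DeltaLift.

End Torsion.
Arguments Delta {A} e M.

Definition induced_map (A : pzRingType) (e : A) (he : e * e = e)
    (F : lmodType A) (hF : torsionfree e F)
    (X : lmodType (corner he)) (q : {linear X -> cornermod F he}) :
    {linear quotmod (Delta e (tensor X)) -> F} :=
  Deltalift (tensor_eps he F) hF \o Deltamap e (tensor_map q).

Section DeltaExtensions.
Variables (A : pzRingType) (e : A) (M Y : lmodType A) (f : {linear M -> Y}).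

Definition essential (L : lmodType A) (i : {linear M -> L}) : Prop :=
  forall N : submodClosed L,
    (forall x, x \in N -> x \in lrange i -> x = 0) ->
    forall x, x \in N -> x = 0.

(* The inclusion of M in L is the injective map [elig_incl]. *)
Record eligible := Eligible {
  elig_mod : lmodType A;
  elig_incl : {linear M -> elig_mod};
  elig_map : {linear elig_mod -> Y};
  elig_incl_inj : injective elig_incl;
  elig_essential : essential elig_incl;
  elig_torsion : torsion e (quotmod (lrange elig_incl));
  elig_compat : forall x, elig_map (elig_incl x) = f x }.

(* As in the definition of isomorphic eligible pairs, [psi] is only required to
   be compatible with the maps to Y, not with the inclusions of M. *)
Definition elig_iso (p p' : eligible) : Prop :=
  exists psi : {linear elig_mod p -> elig_mod p'},
    bijective psi /\ forall x, elig_map p' (psi x) = elig_map p x.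

Definition elig_le (p p' : eligible) : Prop :=
  exists psi : {linear elig_mod p -> elig_mod p'},
    injective psi /\ forall x, elig_map p' (psi x) = elig_map p x.

Definition elig_class (p : eligible) : eligible -> Prop := elig_iso p.

(* The set E_f of isomorphism classes of eligible pairs. *)
Record Dext := DextClass {
  Dext_mem :> eligible -> Prop;
  _ : exists p, Dext_mem = elig_class p }.

Definition Dext_le (C C' : Dext) : Prop :=
  exists p p', [/\ C p, C' p' & elig_le p p'].

Definition Dext_maximal (C : Dext) : Prop :=
  forall C', Dext_le C C' -> C' = C.

End DeltaExtensions.

(* Main.v *)
Require Import Defs.
From HB Require Import structures.
From mathcomp Require Import all_boot all_algebra.
From mathcomp Require Import boolp.
From mathcomp Require classical_sets.

Import GRing.Theory.
Local Open Scope ring_scope.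

(** Restriction M |-> eM detects finite projective dimension on finitely
    generated modules M.  If M has a resolution by projectives P with eP of
    finite projective dimension, so has eM; such P exist because e Lambda is the
    extension of e Lambda e by e Lambda (1 - e).  Conversely, finitely generated
    modules killed by e have finite projective dimension, since their simple
    composition factors are summands of Lambda (1 - e) / J (1 - e); and for a
    projective Q covering eM the map Lambda e (x) Q -> M has a cokernel killed
    by e and a kernel K to which induction applies, eK being a syzygy of eM.

    Hence a map X -> eF can be extended to the Lambda-module L of pairs of a
    homomorphism e Lambda -> X and an element of F that agree in
    Hom(e Lambda, eF).  Maps Y -> L are pairs of compatible maps eY -> X and
    Y -> F, and eL = X, so L -> F is an approximation when X -> eF is; tensoring
    with Lambda e gives the other direction.  L is the maximum of the essential
    Delta-extensions because every eligible pair maps to L by this universal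
    property, injectively as it is torsion-free.  Minimality is transferred
    because endomorphisms of L over F are endomorphisms of X over eF. *)

Set Implicit Arguments.
Unset Strict Implicit.
Unset Printing Implicit Defensive.

(** * Projective dimension *)

Section Linear.
Variable A : pzRingType.

Definition surj (U V : lmodType A) (g : {linear U -> V}) : Prop :=
  forall y, exists x, g x = y.

Definition mklin (U V : lmodType A) (f : U -> V) (fL : linear f) :
    {linear U -> V} :=
  HB.pack f (GRing.isLinear.Build A U V *:%R f fL).

Lemma lin_inj (U V : lmodType A) (f : {linear U -> V}) :
  (forall x, f x = 0 -> x = 0) -> injective f.
Proof.
by move=> f0 x y /eqP; rewrite -subr_eq0 -linearB => /eqP/f0/eqP; rewrite subr_eq0 => /eqP.
Qed.

(** Two values over the same point differ by a value over 0, which vanishes; so [G] is single-valued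
    and any choice function for it is linear. This builds linear maps without explicit formulas. *)
Lemma linear_of_graph (U V : lmodType A) (G : U -> V -> Prop) :
    (forall x, exists y, G x y) -> (forall y, G 0 y -> y = 0) ->
    (forall a x y x' y', G x y -> G x' y' -> G (a *: x + x') (a *: y + y')) ->
  exists h : {linear U -> V}, forall x, G x (h x).
Proof.
move=> /choice [h Gh] G0 GD.
have Gfun x y y' : G x y -> G x y' -> y = y'.
  move=> Gy Gy'; have := GD (-1) _ _ _ _ Gy Gy'.
  by rewrite !scaleN1r addNr => /G0/eqP; rewrite addrC subr_eq0 => /eqP.
have hL : linear h by move=> a x y; apply: Gfun (Gh _) _; apply: GD.
by exists (mklin hL).
Qed.

Lemma factor_inj (U V W : lmodType A) (i : {linear U -> V}) (h : {linear W -> V}) :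
    injective i -> (forall w, exists u, i u = h w) ->
  exists k : {linear W -> U}, forall w, i (k w) = h w.
Proof.
move=> ii ih; apply: (linear_of_graph (G := fun w u => i u = h w)) => //.
  by move=> y; rewrite linear0 -(linear0 i) => /ii.
by move=> a x y x' y' e1 e2; rewrite !linearP e1 e2.
Qed.

Lemma linear_inverse (U V : lmodType A) (h : {linear U -> V}) :
  injective h -> surj h ->
  exists k : {linear V -> U}, cancel h k /\ cancel k h.
Proof.
move=> hi hs; have [|k hk] := factor_inj (h := idfun : {linear V -> V}) hi.
  by move=> w; have [u] := hs w; exists u.
by exists k; split=> // x; apply: hi; rewrite hk.
Qed.

Lemma factor_surj (U V W : lmodType A) (g : {linear U -> V}) (h : {linear U -> W}) :
    surj g -> (forall u, g u = 0 -> h u = 0) ->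
  exists k : {linear V -> W}, forall u, k (g u) = h u.
Proof.
move=> gs gh.
have [||a v w v' w'|k kG] := linear_of_graph (G := fun v w => exists2 u, g u = v & h u = w).
- by move=> v; have [u] := gs v; exists (h u), u.
- by move=> w [u /gh -> <-].
- move=> [u <- <-] [u' <- <-].
  by exists (a *: u + u'); rewrite linearP.
exists k => u; have [u' /eqP e1 <-] := kG (g u).
apply/eqP; rewrite -subr_eq0 -linearB; apply/eqP/gh/eqP.
by rewrite linearB subr_eq0.
Qed.

(** * Submodules as modules, kernels and short exact sequences *)

Section Sub.
Variables (M : lmodType A) (N : submodClosed M).
Record submod := Submod { submod_val :> M; _ : submod_val \in N }.
HB.instance Definition _ := [isSub for submod_val].
HB.instance Definition _ := [Choice of submod by <:].
Fact submod_closed_mem : submod_closed (fun x : M => x \in N).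
Proof.
by split=> [|a x y xN yN]; [exact: (rpred0 N)|apply: (rpredD (S := N)) => //; apply: rpredZ].
Qed.
HB.instance Definition _ := GRing.SubChoice_isSubLmodule.Build A M
  (fun x : M => x \in N) submod (GRing.submod_closed_semi submod_closed_mem).
Definition submod_incl : {linear submod -> M} := val.
Lemma submod_inclP x : submod_incl x \in N. Proof. exact: valP. Qed.
Lemma submod_incl_inj : injective submod_incl. Proof. exact: val_inj. Qed.
Lemma submod_inclE x : x \in N -> exists u, submod_incl u = x.
Proof. by move=> xN; exists (Submod xN). Qed.
End Sub.
Arguments submod_incl {M} N : simpl never.

Section OfProp.
Variables (M : lmodType A) (P : M -> Prop).
Hypothesis (P0 : P 0) (PL : forall a x y, P x -> P y -> P (a *: x + y)).
(** The closure proofs are arguments of the predicate, so that its submodule structure can be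
    inferred from the term itself. *)
Definition propmod_pred & P 0 & (forall a x y, P x -> P y -> P (a *: x + y)) :
  {pred M} := fun x => `[< P x >].
Fact propmod_closed : submod_closed (propmod_pred P0 PL).
Proof.
split=> [|a x y /asboolP Px /asboolP Py]; apply/asboolP => //.
exact: PL.
Qed.
HB.instance Definition _ := GRing.isSubmodClosed.Build A M (propmod_pred P0 PL)
  (GRing.submod_closed_semi propmod_closed).
Definition propmod : submodClosed M := propmod_pred P0 PL.
Lemma propmodP x : x \in propmod <-> P x. Proof. by split=> /asboolP. Qed.
End OfProp.

Section Kernel.
Variables (U V : lmodType A) (g : {linear U -> V}).
Fact lkernel_subproof a x y : g x = 0 -> g y = 0 -> g (a *: x + y) = 0.
Proof. by rewrite linearP => -> ->; rewrite scaler0 addr0. Qed.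
Definition lkernel : submodClosed U := propmod (P := fun x => g x = 0) (linear0 g) lkernel_subproof.
Lemma lkernelP x : x \in lkernel <-> g x = 0. Proof. exact: propmodP. Qed.
End Kernel.

Definition linl (U V : lmodType A) : {linear U -> (U * V)%type}.
Proof.
apply: (@mklin _ _ (fun x => (x, 0))) => a x y.
by congr (_, _); rewrite /= scaler0 addr0.
Defined.
Definition linr (U V : lmodType A) : {linear V -> (U * V)%type}.
Proof.
apply: (@mklin _ _ (fun x => (0, x))) => a x y.
by congr (_, _); rewrite /= scaler0 addr0.
Defined.

Definition lpair (W U V : lmodType A) (f : {linear W -> U}) (g : {linear W -> V}) :
  {linear W -> (U * V)%type}.
Proof.
by apply: (@mklin _ _ (fun x => (f x, g x))) => a x y; congr (_, _); rewrite linearP.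
Defined.

Definition lsum (U V W : lmodType A) (f : {linear U -> W}) (g : {linear V -> W}) :
  {linear (U * V)%type -> W}.
Proof.
apply: (@mklin _ _ (fun x => f x.1 + g x.2)) => a x y /=.
by rewrite !linearP scalerDr addrACA.
Defined.

Definition ses (K P M : lmodType A) (f : {linear K -> P}) (g : {linear P -> M}) : Prop :=
  [/\ injective f, surj g & forall x, g x = 0 <-> exists k, f k = x].

Lemma ses_ker (P M : lmodType A) (g : {linear P -> M}) :
  surj g -> ses (submod_incl (lkernel g)) g.
Proof.
move=> gs; split=> // [|x]; first exact: submod_incl_inj.
split=> [/(lkernelP g)/submod_inclE//|[k <-]].
by apply/(lkernelP g); exact: submod_inclP.
Qed.

Lemma ses_prod (M N : lmodType A) :
  ses (linl M N) (snd : {linear (M * N)%type -> N}).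
Proof.
split=> [x y []//|y|[x y]]; first by exists (0, y).
by split=> [/= ->|[k <-]//]; exists x.
Qed.

Lemma quotpi_surj (M : lmodType A) (N : submodClosed M) : surj (quotpi N).
Proof. by move=> u; exists (repr u); exact: quotpi_repr. Qed.

Lemma quotpi_eq0 (M : lmodType A) (N : submodClosed M) x :
  quotpi N x = 0 <-> x \in N.
Proof. by rewrite -(linear0 (quotpi N)) quotpiE subr0. Qed.

Lemma ses_quot (M : lmodType A) (N : submodClosed M) :
  ses (submod_incl N) (quotpi N).
Proof.
split; [exact: submod_incl_inj|exact: quotpi_surj|move=> x].
split=> [/quotpi_eq0/submod_inclE//|[k <-]].
by apply/quotpi_eq0; exact: submod_inclP.
Qed.

Lemma proj_retract (P M : lmodType A) (i : {linear M -> P}) (r : {linear P -> M}) :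
  cancel i r -> projective P -> projective M.
Proof.
move=> ir pP U V g f gs; have [h gh] := pP U V g (f \o r) gs.
by exists (h \o i) => x; rewrite /= gh /= ir.
Qed.

Lemma proj_prod (P Q : lmodType A) :
  projective P -> projective Q -> projective (P * Q)%type.
Proof.
move=> pP pQ U V g f gs.
have [h gh] := pP U V g (f \o linl P Q) gs.
have [k gk] := pQ U V g (f \o linr P Q) gs.
exists (lsum h k) => -[x y]; rewrite /= linearD gh gk /= -linearD.
by congr (f (_, _)); rewrite /= ?addr0 ?add0r.
Qed.

Lemma proj_split (P M : lmodType A) (g : {linear M -> P}) :
  projective P -> surj g -> exists s : {linear P -> M}, cancel s g.
Proof. by move=> pP gs; have [s] := pP _ _ g idfun gs; exists s. Qed.

Lemma proj_trivial (P : lmodType A) : (forall x : P, x = 0) -> projective P.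
Proof. by move=> P0 U V g f _; exists \0 => x; rewrite (P0 x) !linear0. Qed.

Lemma proj_ring : projective A^o.
Proof.
move=> U V g f gs; have [u gu] := gs (f 1).
have hL : linear (fun a : A^o => (a : A) *: u).
  by move=> a x y; rewrite scalerDl scalerA.
exists (mklin hL) => x /=; rewrite linearZ gu -linearZ.
by congr (f _); exact: (@mulr1 A).
Qed.

(** * Projective dimension by iterated syzygies *)

Fixpoint pd (n : nat) (M : lmodType A) : Prop :=
  if n is n'.+1 then
    exists (K P : lmodType A) (f : {linear K -> P}) (g : {linear P -> M}),
      [/\ ses f g, projective P & pd n' K]
  else projective M.

Lemma pd_iso n (M N : lmodType A) (h : {linear M -> N}) :
  injective h -> surj h -> pd n M -> pd n N.
Proof.
move=> hi hs; case: n => [|n] /=.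
  by have [k [hk kh]] := linear_inverse hi hs; exact: (proj_retract kh).
move=> [K [P [f [g [[fi gs fg] pP pK]]]]]; exists K, P, f, (h \o g); split=> //.
split=> // [y|x]; first by have [x <-] := hs y; have [w <-] := gs x; exists w.
by rewrite -fg /= -[0 in X in X <-> _](linear0 h); split=> [/hi|->].
Qed.

Lemma pd_prod n (K P : lmodType A) : pd n K -> projective P -> pd n (K * P)%type.
Proof.
case: n => [|n] /=; first exact: proj_prod.
move=> [Z [Q [f [g [[fi gs fg] pQ pZ]]]]] pP.
exists Z, (Q * P)%type, (linl Q P \o f), (lpair (g \o fst) snd).
split=> //; last exact: proj_prod.
split=> [x y [] /fi//|[y p]|[x p]]; first by have [x <-] := gs y; exists (x, p).
split=> [[/fg[k <-] ->]|[k [<- <-]]]; first by exists k.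
by congr (_, _); apply/fg; exists k.
Qed.

(** Closure under extensions and under cokernels of injections are proved by one alternating
    induction: extensions at n give cokernels at n, which give extensions at n + 1. *)
Definition pd_ext_closed n : Prop :=
  forall (K M N : lmodType A) (i : {linear K -> M}) (p : {linear M -> N}),
    ses i p -> pd n K -> pd n N -> pd n M.

Definition pd_coker_closed n : Prop :=
  forall (K M N : lmodType A) (i : {linear K -> M}) (p : {linear M -> N}),
    ses i p -> pd n K -> pd n.+1 M -> pd n.+1 N.

Lemma pd_ext0 : pd_ext_closed 0.
Proof.
move=> K M N i p [ii ps ip] /= pK pN; have [s sp] := proj_split pN ps.
apply: (pd_iso (n := 0%N) (h := lsum i s)) (proj_prod pK pN) => [|x].
  apply: lin_inj => -[k y] /= e0; have := congr1 p e0.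
  rewrite linearD linear0 sp (_ : p (i k) = 0) ?add0r => [y0|].
    by move: e0; rewrite y0 linear0 addr0 -(linear0 i) => /ii ->.
  by apply/ip; exists k.
have /ip[k ek] : p (x - s (p x)) = 0 by rewrite linearB sp subrr.
by exists (k, p x); rewrite /= ek subrK.
Qed.

(* If l : P -> M lifts a projective cover P -> N of the cokernel, the kernel of
   (i, l) : K * P -> M is the kernel of P -> N. *)
Lemma pd_ext_of_coker n : pd_coker_closed n -> pd_ext_closed n.+1.
Proof.
move=> cokn K M N i p [ii ps ip] pK [Z [P [z [g [[zi gs zg] pP pZ]]]]].
have [l pl] := pP _ _ p g ps.
have [|k ik] := factor_inj (h := l \o z) ii.
  by move=> w; apply/ip; rewrite /= pl; apply/zg; exists w.
apply: (cokn Z (K * P)%type _ (lpair (\- k) z) (lsum i l)) => //; last first.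
  exact: (pd_prod (n := n.+1)).
split=> [x y [_ /zi]//|m|[x y] /=].
  have [y gy] := gs (p m); have /ip[x ix] : p (m - l y) = 0.
    by rewrite linearB pl gy subrr.
  by exists (x, y); rewrite /= ix subrK.
split=> [e0|[w [<- <-]]]; last by rewrite linearN /= ik addNr.
have := congr1 p e0; rewrite linearD linear0 pl (_ : p (i x) = 0) ?add0r.
  move=> /zg[w ew]; exists w; rewrite /= ew; congr (_, _); apply: ii.
  by rewrite linearN /= ik /= ew; apply/esym/eqP; rewrite -addr_eq0 e0.
by apply/ip; exists x.
Qed.

(** If Z is the kernel of P -> M with P projective, then the kernel of the composite P -> M -> N is
    an extension of K by Z. *)
Lemma pd_coker_of_ext n : pd_ext_closed n -> pd_coker_closed n.
Proof.
move=> ext K M N i p [ii ps ip] pK [Z [P [z [g [[zi gs zg] pP pZ]]]]].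
have pgs : surj (p \o g).
  by move=> y; have [x <-] := ps y; have [w <-] := gs x; exists w.
have [vi _ vE] := ses_ker pgs; set v := submod_incl _ in vi vE.
have [|z' vz] := factor_inj (h := z) vi.
  by move=> w; apply/vE; rewrite /= (_ : g _ = 0) ?linear0//; apply/zg; exists w.
have [|k ik] := factor_inj (h := g \o v) ii.
  by move=> w; apply/ip; apply/vE; exists w.
exists _, P, v, (p \o g); split; [exact: ses_ker|by []|].
apply: (ext _ _ _ z' k) => //; split=> [x y /(congr1 v)|y|x].
- by rewrite !vz => /zi.
- have [x gx] := gs (i y); have /vE[w ew] : (p \o g) x = 0.
    by rewrite /= gx; apply/ip; exists y.
  by exists w; apply: ii; rewrite ik -gx -ew.
have -> : k x = 0 <-> g (v x) = 0.
  by rewrite -[g _]/((g \o v) x) -ik; split=> [->|]; rewrite ?linear0// -(linear0 i) => /ii.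
split=> [/zg[w ew]|[w <-]]; last by rewrite vz; apply/zg; exists w.
by exists w; apply: vi; rewrite vz.
Qed.

Lemma pd_ext n : pd_ext_closed n.
Proof.
elim: n => [|n IH]; first exact: pd_ext0.
exact/pd_ext_of_coker/pd_coker_of_ext.
Qed.

Lemma pd_coker n : pd_coker_closed n.
Proof. exact/pd_coker_of_ext/pd_ext. Qed.

(** Closure under direct summands and independence of the syzygy from the chosen projective are
    again proved by a joint induction, each feeding the other. *)
Definition pd_retract_closed n : Prop :=
  forall (M N : lmodType A) (i : {linear M -> N}) (r : {linear N -> M}),
    cancel i r -> pd n N -> pd n M.

Definition pd_syzygy_closed n : Prop :=
  forall (K P M : lmodType A) (f : {linear K -> P}) (g : {linear P -> M}),
    ses f g -> projective P -> pd n.+1 M -> pd n K.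

(* Schanuel's lemma: K is a direct summand of K' * P, which is isomorphic to
   K * P'. *)
Lemma pd_syzygy_of_retract n : pd_retract_closed n -> pd_syzygy_closed n.
Proof.
move=> ret K P M f g [fi gs fg] pP [K' [P' [f' [g' [[fi' gs' fg'] pP' pK']]]]].
have [a ga] := pP _ _ g' g gs'; have [b gb] := pP' _ _ g g' gs.
have [|k fk] := factor_inj (h := a \o f) fi'.
  by move=> x; apply/fg'; rewrite /= ga; apply/fg; exists x.
have [|r fr] := factor_inj (W := (K' * P)%type)
    (h := snd \- (b \o lsum f' a) : {linear (K' * P)%type -> P}) fi.
  move=> [x y]; apply/fg; rewrite /= linearB gb linearD ga.
  by rewrite (_ : g' (f' x) = 0) ?add0r ?subrr//; apply/fg'; exists x.
apply: (ret _ (K' * P)%type (lpair (\- k) f) r); last exact: pd_prod.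
by move=> x; apply: fi; rewrite fr /= linearN /= fk addNr linear0 subr0.
Qed.

(** N is the sum of M and the kernel of r, so P * P covers N through [h], one factor for each
    summand. The kernel of [h] is a syzygy of N and has the kernel of P -> N -> M as a direct
    summand. *)
Lemma pd_retract_of_syzygy n :
  pd_retract_closed n -> pd_syzygy_closed n -> pd_retract_closed n.+1.
Proof.
move=> ret syz M N i r ir pN; have [K [P [f [g [fg pP pK]]]]] := pN.
have [_ gs _] := fg.
have rgs : surj (r \o g).
  by move=> y; have [x gx] := gs (i y); exists x; rewrite /= gx ir.
exists _, P, (submod_incl (lkernel (r \o g))), (r \o g); split; [exact: ses_ker|by []|].
pose c : {linear N -> N} := idfun \- (i \o r).
pose h := lsum (i \o r \o g) (c \o g).
have hs : surj h.
  move=> y; have [x gx] := gs y; exists (x, x).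
  by rewrite /= gx addrC subrK.
have [_ _ hE] := ses_ker hs.
have := syz _ _ _ _ _ (ses_ker hs) (proj_prod pP pP) pN.
have [|j hj] := factor_inj (h := linl P P \o submod_incl (lkernel (r \o g)))
    (submod_incl_inj (N := lkernel h)).
  move=> w; apply/hE => /=; have /(lkernelP (r \o g)) /= -> := submod_inclP w.
  by rewrite !linear0 !addr0.
have [|s hs'] := factor_inj (h := fst \o submod_incl (lkernel h))
    (submod_incl_inj (N := lkernel (r \o g))).
  move=> w; apply/submod_inclE/(lkernelP (r \o g)) => /=.
  have /(lkernelP h) /= /(congr1 r) := submod_inclP w.
  by rewrite linearD ir linearB ir subrr addr0 linear0.
apply: (ret _ _ j s) => w; apply: (submod_incl_inj (N := lkernel (r \o g))).
by rewrite hs' [LHS](congr1 fst (hj w)).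
Qed.

Lemma pd_retract n : pd_retract_closed n.
Proof.
elim: n => [|n IH]; first by move=> M N i r ir; exact: (proj_retract ir).
exact/pd_retract_of_syzygy/pd_syzygy_of_retract.
Qed.

Lemma pd_syzygy n : pd_syzygy_closed n.
Proof. exact/pd_syzygy_of_retract/pd_retract. Qed.

Lemma pd_leS n M : pd n M -> pd n.+1 M.
Proof.
elim: n M => [M pM|n IH M [K [P [f [g [fg pP pK]]]]]]; last first.
  by exists K, P, f, g; split=> //; exact: IH.
have ids : surj (idfun : {linear M -> M}) by move=> y; exists y.
exists _, M, (submod_incl (lkernel idfun)), idfun.
split; [exact: ses_ker|by []|apply: proj_trivial => x].
by apply: submod_incl_inj; rewrite linear0; exact/(lkernelP idfun)/submod_inclP.
Qed.

Lemma pd_le m n M : (m <= n)%N -> pd m M -> pd n M.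
Proof.
move=> /subnK <-; elim: (n - m)%N => // k IH /IH.
exact: pd_leS.
Qed.

(** A resolution is cut at degree 0 in one direction; in the other, one projective is spliced in
    front of a resolution of the syzygy. *)
Lemma pdim_leP n M : pdim_le M n <-> pd n M.
Proof.
split.
  elim: n M => [|n IH] M [P [d [eps [pP P0 es eE dE]]]].
    apply: (pd_iso (n := 0%N) (h := eps)) es (pP 0%N).
    apply: lin_inj => x /eE[y <-]; rewrite (P0 1%N _ y) ?linear0//.
  exists _, (P 0%N), (submod_incl (lkernel eps)), eps; split; [exact: ses_ker|by []|apply: IH].
  have [|k ik] := factor_inj (h := d 0%N) (submod_incl_inj (N := lkernel eps)).
    by move=> w; apply/submod_inclE/(lkernelP eps)/eE; exists w.
  exists (fun i => P i.+1), (fun i => d i.+1), k; split=> // [i ni|y|x].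
  - exact: P0.
  - have /(lkernelP eps)/eE[x dx] := submod_inclP y.
    by exists x; apply: submod_incl_inj; rewrite ik.
  rewrite -dE -ik; split=> [->|]; first by rewrite linear0.
  by rewrite -(linear0 (submod_incl (lkernel eps))) => /submod_incl_inj.
elim: n M => [|n IH] M.
  (* The kernel of the identity is a zero module; it fills all positive degrees of the
     resolution. *)
  move=> pM; pose Z : lmodType A := submod (lkernel (idfun : {linear M -> M})).
  have Z0 (x : Z) : x = 0.
    by apply: submod_incl_inj; rewrite linear0; exact/(lkernelP idfun)/submod_inclP.
  exists (fun i => if i is 0%N then M else Z), (fun i => \0), idfun.
  split=> // [[|i] //|[|i]//|y|x|i x].
  - exact: proj_trivial.
  - by exists y.
  - by split=> [/= ->|[y <-]]//; exists 0.
  by split=> // _; exists 0; rewrite linear0 (Z0 x).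
move=> [K [P [f [g [[fi gs fg] pP /IH[Q [d [eps [pQ Q0 es eE dE]]]]]]]]].
pose P' i := if i is i'.+1 then Q i' else P.
exists P', (fun i => match i return {linear P' i.+1 -> P' i} with
  i'.+1 => d i' | 0%N => f \o eps end), g.
split=> // [[|i] //|[|i] ni//|x|[|i] x].
- exact: pQ.
- exact: Q0.
- rewrite fg; split=> [[k <-]|[y <-]]; last by exists (eps y).
  by have [y <-] := es k; exists y.
- rewrite -eE /=; split=> [|->]; last exact: linear0.
  by rewrite -(linear0 f) => /fi.
exact: dE.
Qed.

Lemma finite_pdim_pd M : finite_pdim M <-> exists n, pd n M.
Proof. by split=> -[n /pdim_leP Mn]; exists n. Qed.

Lemma finite_pdim_iso (M N : lmodType A) (h : {linear M -> N}) :
  injective h -> surj h -> finite_pdim M -> finite_pdim N.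
Proof.
move=> hi hs /finite_pdim_pd[n Mn]; apply/finite_pdim_pd; exists n.
exact: (pd_iso hi hs).
Qed.

Lemma finite_pdim_retract (M N : lmodType A) (i : {linear M -> N}) (r : {linear N -> M}) :
  cancel i r -> finite_pdim N -> finite_pdim M.
Proof.
move=> ir /finite_pdim_pd[n Mn]; apply/finite_pdim_pd; exists n.
exact: (pd_retract ir).
Qed.

Lemma projective_finite_pdim (P : lmodType A) : projective P -> finite_pdim P.
Proof. by move=> pP; apply/finite_pdim_pd; exists 0%N. Qed.

Lemma finite_pdim_ext (K M N : lmodType A) (i : {linear K -> M}) (p : {linear M -> N}) :
  ses i p -> finite_pdim K -> finite_pdim N -> finite_pdim M.
Proof.
move=> ip /finite_pdim_pd[m Km] /finite_pdim_pd[n Nn]; apply/finite_pdim_pd.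
exists (maxn m n); apply: (pd_ext ip).
  exact: pd_le (leq_maxl _ _) Km.
exact: pd_le (leq_maxr _ _) Nn.
Qed.

Lemma finite_pdim_coker (K M N : lmodType A) (i : {linear K -> M}) (p : {linear M -> N}) :
  ses i p -> finite_pdim K -> finite_pdim M -> finite_pdim N.
Proof.
move=> ip /finite_pdim_pd[m Km] /finite_pdim_pd[n Mn]; apply/finite_pdim_pd.
exists (maxn m n).+1; apply: (pd_coker ip).
  exact: pd_le (leq_maxl _ _) Km.
exact/pd_leS/(pd_le (leq_maxr _ _) Mn).
Qed.

Lemma finite_pdim_trivial (M : lmodType A) : (forall x : M, x = 0) -> finite_pdim M.
Proof. by move=> /proj_trivial/projective_finite_pdim. Qed.

End Linear.

(** * Chain conditions over an artinian commutative ring *)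

Section Span.
Variable A : pzRingType.

(** With [Prop]-valued predicates, images and intersections need no boolean reflection, and a
    submodule remains one when scalars are restricted. *)
Definition is_submod (M : lmodType A) (P : M -> Prop) : Prop :=
  P 0 /\ forall a x y, P x -> P y -> P (a *: x + y).

Section SubmodTheory.
Variables (M : lmodType A) (P : M -> Prop).
Hypothesis subP : is_submod P.
Lemma sub0 : P 0. Proof. by case: subP. Qed.
Lemma subL a x y : P x -> P y -> P (a *: x + y).
Proof. by case: subP => _; apply. Qed.
Lemma subD x y : P x -> P y -> P (x + y).
Proof. by move=> Px; rewrite -[x]scale1r; exact: subL. Qed.
Lemma subZ a x : P x -> P (a *: x).
Proof. by move=> Px; rewrite -[_ *: _]addr0; exact: subL sub0. Qed.
Lemma subB x y : P x -> P y -> P (x - y).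
Proof. by move=> Px Py; rewrite addrC -scaleN1r; exact: subL. Qed.
End SubmodTheory.

Lemma is_submodI (M : lmodType A) (P Q : M -> Prop) :
  is_submod P -> is_submod Q -> is_submod (fun x => P x /\ Q x).
Proof.
move=> sP sQ; split=> [|a x y [Px Qx] [Py Qy]]; first by split; exact: sub0.
by split; exact: subL.
Qed.

Lemma is_submod_mem (M : lmodType A) (N : submodClosed M) :
  is_submod (fun x => x \in N).
Proof. by split=> [|a x y xN yN]; [exact: rpred0|rewrite rpredD// rpredZ]. Qed.

Lemma is_submod_ker (M V : lmodType A) (g : {linear M -> V}) :
  is_submod (fun x => g x = 0).
Proof. by split; [exact: linear0|exact: lkernel_subproof]. Qed.

Lemma is_submod_image (M V : lmodType A) (g : {linear M -> V}) P :
  is_submod P -> is_submod (fun y => exists2 x, P x & g x = y).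
Proof.
move=> sP; split=> [|a _ _ [x Px <-] [y Py <-]].
  by exists 0; [exact: sub0|rewrite linear0].
by exists (a *: x + y); [exact: subL|rewrite linearP].
Qed.

Definition submod_of (M : lmodType A) (P : M -> Prop) (sP : is_submod P) :
  submodClosed M := propmod (proj1 sP) (proj2 sP).

Lemma submod_ofP (M : lmodType A) (P : M -> Prop) (sP : is_submod P) x :
  x \in submod_of sP <-> P x.
Proof. exact: propmodP. Qed.

Lemma is_submod_adjoin (M : lmodType A) (P : M -> Prop) (z : M) :
  is_submod P -> is_submod (fun x => exists a : A, P (x - a *: z)).
Proof.
move=> sP; split=> [|a x y [b Pb] [c Pc]].
  by exists 0; rewrite scale0r subr0; exact: sub0.
exists (a * b + c); rewrite scalerDl opprD addrACA -scalerA -scalerBr.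
exact: subL.
Qed.

(** The recursive form of the span removes one generator at a time, which suits induction on the
    list; [inspanP] relates it to linear combinations. *)
Fixpoint inspan (M : lmodType A) (s : seq M) (x : M) : Prop :=
  if s is y :: s' then exists a : A, inspan s' (x - a *: y) else x = 0.

Lemma is_submod_inspan (M : lmodType A) (s : seq M) : is_submod (inspan s).
Proof.
by elim: s => [|y s IH] /=; [split=> // a x y -> ->; rewrite scaler0 addr0|exact: is_submod_adjoin].
Qed.

Lemma inspanP (M : lmodType A) (s : seq M) x :
  inspan s x <-> exists c : 'I_(size s) -> A, x = \sum_(i < size s) c i *: s`_i.
Proof.
elim: s x => [|y s IH] x /=.
  by split=> [->|[c ->]]; rewrite ?big_ord0//; exists (fun=> 0); rewrite big_ord0.
split=> [[a /IH[c xE]]|[c ->]].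
  exists (fun i => if unlift ord0 i is Some j then c j else a).
  rewrite big_ord_recl unlift_none /= -[LHS](subrK (a *: y)) xE addrC.
  by congr (_ + _); apply: eq_bigr => i _; rewrite liftK.
exists (c ord0); apply/IH; exists (fun i => c (lift ord0 i)).
by rewrite big_ord_recl /= addrC addKr.
Qed.

Lemma fg_inspan (M : lmodType A) :
  finitely_generated M <-> exists s : seq M, forall x, inspan s x.
Proof. by split=> -[s sM]; exists s => x; apply/inspanP. Qed.

Lemma inspan_sub (M : lmodType A) (s : seq M) P x :
  is_submod P -> (forall y, y \in s -> P y) -> inspan s x -> P x.
Proof.
move=> sP; elim: s x => [|y s IH] x Ps /=; first by move=> ->; exact: sub0.
move=> [a /IH Px]; rewrite -(subrK (a *: y) x); apply: subD => //.
  by apply: Px => z zs; apply: Ps; rewrite inE zs orbT.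
by apply: subZ => //; apply: Ps; rewrite inE eqxx.
Qed.

Lemma inspan_mem (M : lmodType A) (s : seq M) y : y \in s -> inspan s y.
Proof.
elim: s => // x s IH; rewrite inE => /orP[/eqP ->|/IH ys] /=.
  by exists 1; rewrite scale1r subrr; apply: sub0; exact: is_submod_inspan.
by exists 0; rewrite scale0r subr0.
Qed.

Lemma inspan_incl (M : lmodType A) (s t : seq M) x :
  {subset s <= t} -> inspan s x -> inspan t x.
Proof.
move=> st; apply: inspan_sub => [|y /st]; first exact: is_submod_inspan.
exact: inspan_mem.
Qed.

Lemma inspan_map (M V : lmodType A) (g : {linear M -> V}) s x :
  inspan s x -> inspan (map g s) (g x).
Proof.
elim: s x => [|y s IH] x /=; first by move=> ->; rewrite linear0.
by move=> [a /IH H]; exists a; rewrite -linearZ -linearB.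
Qed.

Lemma inspan_map_lift (M V : lmodType A) (g : {linear M -> V}) s y :
  inspan (map g s) y -> exists2 x, inspan s x & g x = y.
Proof.
elim: s y => [|z s IH] y /=; first by move=> ->; exists 0; rewrite ?linear0.
move=> [a /IH[x sx gx]]; exists (x + a *: z).
  by exists a; rewrite addrK.
by rewrite linearD linearZ gx subrK.
Qed.

Definition fg_sub (M : lmodType A) (P : M -> Prop) : Prop :=
  exists s : seq M, (forall y, y \in s -> P y) /\ forall x, P x -> inspan s x.

Definition noetherian (M : lmodType A) : Prop :=
  forall P : M -> Prop, is_submod P -> fg_sub P.

Lemma fg_subE (M : lmodType A) (N : submodClosed M) :
  fg_sub (fun x => x \in N) <-> finitely_generated (submod N).
Proof.
split=> [[s [sN Ns]]|].
  have {sN} [t ts] : exists t : seq (submod N), map (submod_incl N) t = s.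
    elim: s sN {Ns} => [|y s IH] sN; first by exists [::].
    have [|t <-] := IH; first by move=> z zs; apply: sN; rewrite inE zs orbT.
    have /submod_inclE[u <-] : y \in N by apply: sN; rewrite inE eqxx.
    by exists (u :: t).
  apply/fg_inspan; exists t => x; move: (Ns _ (submod_inclP x)); rewrite -ts.
  by move=> /inspan_map_lift[u us /submod_incl_inj <-].
move=> /fg_inspan[t tN]; exists (map (submod_incl N) t); split.
  by move=> _ /mapP[u _ ->]; exact: submod_inclP.
by move=> x /submod_inclE[u <-]; exact: inspan_map.
Qed.

Lemma noetherian_fg (M : lmodType A) : noetherian M -> finitely_generated M.
Proof.
move=> nM; have [|s [_ sM]] := nM (fun=> True); first by split.
by apply/fg_inspan; exists s => x; exact: sM.
Qed.

Lemma fg_surj (M V : lmodType A) (g : {linear M -> V}) :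
  surj g -> finitely_generated M -> finitely_generated V.
Proof.
move=> gs /fg_inspan[s sM]; apply/fg_inspan; exists (map g s) => y.
by have [x <-] := gs y; exact: inspan_map.
Qed.

(** Lifts to [P] of generators of its image under [g], joined to generators of its part killed by
    [g], generate [P]. Finite generation can thus be checked one map at a time. *)
Lemma fg_sub_step (M V : lmodType A) (g : {linear M -> V}) P :
  noetherian V -> is_submod P -> fg_sub (fun x => P x /\ g x = 0) -> fg_sub P.
Proof.
move=> nV sP [t [tP Pt]]; have [s [sI Is]] := nV _ (is_submod_image g sP).
have [r [rP rs]] : exists r, (forall y, y \in r -> P y) /\ map g r = s.
  elim: s sI {Is} => [|y s IH] sI; first by exists [::].
  have [|r [rP <-]] := IH; first by move=> z zs; apply: sI; rewrite inE zs orbT.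
  have [x Px <-] : exists2 x, P x & g x = y by apply: sI; rewrite inE eqxx.
  by exists (x :: r); split=> // z; rewrite inE => /orP[/eqP ->|/rP].
exists (r ++ t); split=> [y|x Px].
  by rewrite mem_cat => /orP[/rP|/tP[]].
have : inspan (map g r) (g x) by rewrite rs; apply: Is; exists x.
move=> /inspan_map_lift[z zr gz]; rewrite -(subrK z x).
apply: (subD (is_submod_inspan _)).
  apply: inspan_incl (Pt _ _) => [y yt|]; first by rewrite mem_cat yt orbT.
  split; last by rewrite linearB gz subrr.
  by apply: subB => //; exact: inspan_sub zr.
by apply: inspan_incl zr => y yr; rewrite mem_cat yr.
Qed.

Lemma fg_ext (K M N : lmodType A) (i : {linear K -> M}) (p : {linear M -> N}) :
  ses i p -> finitely_generated K -> finitely_generated N -> finitely_generated M.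
Proof.
move=> [_ ps ip] /fg_inspan[s sK] /fg_inspan[t tN].
have [r rt] : exists r, map p r = t.
  elim: t {tN} => [|y t [r <-]]; first by exists [::].
  by have [x <-] := ps y; exists (x :: r).
apply/fg_inspan; exists (r ++ map i s) => x.
have : inspan (map p r) (p x) by rewrite rt.
move=> /inspan_map_lift[z zr pz]; rewrite -(subrK z x).
apply: (subD (is_submod_inspan _)); last first.
  by apply: inspan_incl zr => y yr; rewrite mem_cat yr.
have /ip[k <-] : p (x - z) = 0 by rewrite linearB pz subrr.
apply: inspan_incl (inspan_map i (sK k)) => y yt.
by rewrite mem_cat yt orbT.
Qed.

Lemma fg_prod (M N : lmodType A) :
  finitely_generated M -> finitely_generated N -> finitely_generated (M * N)%type.
Proof. exact: fg_ext (ses_prod M N). Qed.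

Lemma fg_ring : finitely_generated A^o.
Proof.
apply/fg_inspan; exists [:: 1] => x; exists x.
by rewrite [_ *: _](@mulr1 A) subrr.
Qed.

Definition dcc (M : lmodType A) : Prop :=
  forall I : nat -> M -> Prop, (forall n, is_submod (I n)) ->
    (forall n x, I n.+1 x -> I n x) ->
    exists n, forall m, (n <= m)%N -> forall x, I n x -> I m x.

Lemma chain_sub (M : lmodType A) (I : nat -> M -> Prop) m n :
  (forall n x, I n.+1 x -> I n x) -> (m <= n)%N -> forall x, I n x -> I m x.
Proof.
by move=> Id /subnK <-; elim: (n - m)%N => // k IH x /Id; exact: IH.
Qed.

(** Without a minimal member, choice would produce an infinite strictly descending chain. *)
Lemma dcc_min (M : lmodType A) (C : (M -> Prop) -> Prop) :
    dcc M -> (exists I, is_submod I /\ C I) ->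
  exists I, [/\ is_submod I, C I &
    forall J, is_submod J -> C J -> (forall x, J x -> I x) -> forall x, I x -> J x].
Proof.
move=> dM [I0 CI0]; apply: contrapT => noMin.
have next (I : {I : M -> Prop | is_submod I /\ C I}) :
    exists J : {I : M -> Prop | is_submod I /\ C I},
      (forall x, sval J x -> sval I x) /\ ~ forall x, sval I x -> sval J x.
  case: I => I [sI CI]; apply: contrapT => noJ; apply: noMin.
  exists I; split=> // J sJ CJ JI; apply: contrapT => IJ; apply: noJ.
  by exists (exist _ J (conj sJ CJ)).
have [F FP] := choice next.
pose ch n := iter n F (exist _ I0 CI0).
have [n|n|n nP] := dM (fun n => sval (ch n)).
- by case: (ch n) => J [].
- by case: (FP (ch n)) => + _; apply.
by case: (FP (ch n)) => _; apply; exact: (nP n.+1).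
Qed.

(** Zorn's lemma gives W maximal among the submodules that contain P and avoid x. For y outside W,
    the larger submodule W + A y must contain x; this is the last clause. *)
Lemma max_avoiding (M : lmodType A) (P : M -> Prop) (x : M) :
    is_submod P -> ~ P x ->
  exists W, [/\ is_submod W, forall y, P y -> W y, ~ W x &
    forall y, ~ W y -> exists a : A, W (x - a *: y)].
Proof.
move=> sP Px.
pose T := {W : M -> Prop | [/\ is_submod W, forall y, P y -> W y & ~ W x]}.
have t0 : T by exists P.
pose R (U V : T) := `[< forall y, sval U y -> sval V y >].
have [U|U V W /asboolP UV /asboolP VW|C Ctot|[W [sW PW Wx]] maxW] :=
    @classical_sets.ZL_preorder T t0 R.
- exact/asboolP.
- by apply/asboolP => y /UV/VW.
- have [[U CU]|noC] := pselect (exists U, C U); last first.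
    by exists t0 => U CU; case: noC; exists U.
  pose W y := exists2 V, C V & sval V y.
  have sW : is_submod W.
    split=> [|a y z [V CV Vy] [V' CV' Vz]].
      by exists U => //; case: (svalP U) => /sub0.
    have [/asboolP VV'|/asboolP V'V] := Ctot _ _ CV CV'.
      exists V' => //; case: (svalP V') => sV' _ _.
      by apply: subL => //; exact: VV'.
    exists V => //; case: (svalP V) => sV _ _.
    by apply: subL => //; exact: V'V.
  have WP : [/\ is_submod W, forall y, P y -> W y & ~ W x].
    split=> // [y Py|[V CV]]; last by case: (svalP V).
    by exists U => //; case: (svalP U) => _ + _; apply.
  by exists (exist _ W WP) => V CV; apply/asboolP => y Vy; exists V.
exists W; split=> // y Wy; apply: contrapT => noa.
have sW' := is_submod_adjoin y sW.
have W'P : [/\ is_submod (fun z => exists a, W (z - a *: y)),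
    forall z, P z -> exists a, W (z - a *: y) & ~ exists a, W (x - a *: y)].
  by split=> // z /PW Wz; exists 0; rewrite scale0r subr0.
have /asboolP W'W : R (exist _ _ W'P) (exist _ W (And3 sW PW Wx)).
  apply: maxW; apply/asboolP => z /= Wz.
  by exists 0; rewrite scale0r subr0.
apply: Wy; apply: W'W => /=.
by exists 1; rewrite scale1r subrr; exact: sub0.
Qed.

Section FgOverRing.
Variables (M : lmodType A).

(** As in Hilbert's basis theorem, the coefficients of [y] in elements of [P] form a left ideal [I].
    Finitely many generators of [I] are lifted to [P], and subtracting combinations of the lifts
    leads back to the span of the shorter list. *)
Lemma noetherian_span (s : seq M) (P : M -> Prop) :
  noetherian A^o -> is_submod P -> fg_sub (fun x => P x /\ inspan s x).
Proof.
move=> nA sP; elim: s => [|y s [t [tP Pt]]].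
  by exists [::]; split=> // x /= [].
pose I (r : A^o) := exists2 z, inspan s z & P ((r : A) *: y + z).
have sI : is_submod I.
  split=> [|a r r' [z sz Pz] [z' sz' Pz']].
    by exists 0; rewrite ?scale0r ?addr0; [exact: sub0 (is_submod_inspan _)|exact: sub0].
  exists (a *: z + z'); first exact: subL (is_submod_inspan _) _ _ _ sz sz'.
  by rewrite scalerDl addrACA -scalerA -scalerDr; exact: subL.
have [u [uI Iu]] := nA I sI.
have [v [vP vu]] : exists v, (forall w, w \in v -> P w /\ inspan (y :: s) w) /\
    forall r : A^o, inspan u r -> exists2 w, inspan v w & inspan s (w - (r : A) *: y).
  elim: u uI {Iu} => [|r0 u IH] uI.
    exists [::]; split=> // _ ->; exists 0 => //.
    by rewrite scale0r subr0; exact: sub0 (is_submod_inspan _).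
  have [|v [vP vu]] := IH; first by move=> r ru; apply: uI; rewrite inE ru orbT.
  have [z sz Pz] : I r0 by apply: uI; rewrite inE eqxx.
  exists (((r0 : A) *: y + z) :: v); split.
    move=> w; rewrite inE => /orP[/eqP ->|/vP//]; split=> //.
    by exists r0; rewrite addrC addKr.
  move=> r [a /vu[w vw sw]]; exists (w + a *: ((r0 : A) *: y + z)).
    by exists a; rewrite addrK.
  have -> : w + a *: ((r0 : A) *: y + z) - (r : A) *: y =
      a *: z + (w - (r - a *: r0 : A) *: y).
    rewrite scalerDr scalerBl opprB -scalerA [RHS]addrCA -addrA.
    by rewrite (addrC (a *: (_ *: y))) -[in LHS]addrA.
  exact: subL (is_submod_inspan _) _ _ _ sz sw.
exists (v ++ t); split=> [w|x [Px [a sx]]].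
  rewrite mem_cat => /orP[/vP//|/tP[Pw sw]]; split=> //.
  by exists 0; rewrite scale0r subr0.
have /Iu/vu[w vw sw] : I a by exists (x - a *: y) => //; rewrite addrC subrK.
rewrite -(subrK w x); apply: (subD (is_submod_inspan _)); last first.
  by apply: inspan_incl vw => z zv; rewrite mem_cat zv.
apply: inspan_incl (Pt _ _) => [z zt|]; first by rewrite mem_cat zt orbT.
split; first by apply: subB => //; apply: inspan_sub vw => // z /vP[].
rewrite -[x](subrK (a *: y)) -addrA -[_ - w]opprB.
exact: subB (is_submod_inspan _) _ _ sx sw.
Qed.

Lemma noetherian_of_fg : noetherian A^o -> finitely_generated M -> noetherian M.
Proof.
move=> nA /fg_inspan[s sM] P sP; have [t [tP Pt]] := noetherian_span s nA sP.
by exists t; split=> [y /tP[]//|x Px]; apply: Pt.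
Qed.

(** The coefficients of [y] form a descending chain [K] of left ideals. Once [K] and the parts in
    the span of [s] are both stationary, an element of the earlier term is matched by one of the
    later term with the same coefficient, and their difference lies in the span of [s]. *)
Lemma dcc_span (s : seq M) (I : nat -> M -> Prop) :
    dcc A^o -> (forall n, is_submod (I n)) -> (forall n x, I n.+1 x -> I n x) ->
  exists n, forall m, (n <= m)%N -> forall x, inspan s x -> I n x -> I m x.
Proof.
move=> dA sI Id; elim: s => [|y s [n1 IH]].
  by exists 0%N => m _ x /= -> _; exact: sub0.
pose K n (r : A^o) := exists2 z, inspan s z & I n ((r : A) *: y + z).
have [n|n r [z sz /Id]|n2 nK] := dA K.
- split=> [|a r r' [z sz Pz] [z' sz' Pz']].
    by exists 0; rewrite ?scale0r ?addr0; [exact: sub0 (is_submod_inspan _)|exact: sub0].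
  exists (a *: z + z'); first exact: subL (is_submod_inspan _) _ _ _ sz sz'.
  by rewrite scalerDl addrACA -scalerA -scalerDr; exact: subL.
- by exists z.
exists (maxn n1 n2) => m; rewrite geq_max => /andP[n1m n2m] x [a sx] Ix.
have Ix2 : I n2 x := chain_sub Id (leq_maxr n1 n2) Ix.
have Ix1 : I n1 x := chain_sub Id (leq_maxl n1 n2) Ix.
have [|z sz Iz] := nK m n2m a; first by exists (x - a *: y) => //; rewrite addrC subrK.
rewrite -(subrK (a *: y + z) x); apply: subD => //; apply: IH => //.
  by rewrite opprD addrA; exact: subB (is_submod_inspan _) _ _ sx sz.
apply: subB => //; exact: (chain_sub Id n1m).
Qed.

Lemma dcc_of_fg : dcc A^o -> finitely_generated M -> dcc M.
Proof.
move=> dA /fg_inspan[s sM] I sI Id; have [n nP] := dcc_span s dA sI Id.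
by exists n => m nm x; exact: nP.
Qed.
End FgOverRing.
End Span.

(** * Artinian commutative rings are noetherian *)

Section Hopkins.
Variable R : comPzRingType.

Lemma artinian_dcc : artinian R -> dcc R^o.
Proof.
move=> aR I sI Id; have [|n nP] := aR (fun n => submod_of (sI n)).
  by move=> n x /submod_ofP/Id Ix; apply/submod_ofP.
exists n => m /nP nm x /(submod_ofP (sI n)).
by rewrite -nm => /submod_ofP.
Qed.

(** This is finite generation of the image of [P] in R/I, stated without forming the quotient. *)
Definition fg_modulo (I P : R^o -> Prop) : Prop :=
  exists s : seq R^o, (forall y, y \in s -> P y) /\
    forall x, P x -> exists2 z, I z & inspan s (x - z).

(* Hopkins: let I be minimal with R/I noetherian and suppose that I is nonzero.
   If R b is minimal with b I nonzero, then b I is a vector space over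
   R/Ann(b I), so it has a simple quotient, whose kernel pulls back to a smaller
   ideal I' with I/I' simple. *)
Lemma artinian_noetherian : artinian R -> noetherian R^o.
Proof.
move=> /artinian_dcc dR.
pose C I := forall P, is_submod P -> fg_modulo I P.
have [|I [sI CI minI]] := dcc_min (C := C) dR.
  exists (fun=> True); split=> [//|P sP]; exists [::]; split=> // x _.
  by exists x => //; rewrite subrr.
suff I0 x : I x -> x = 0.
  move=> P /CI[s [sP Ps]]; exists s; split=> // x /Ps[z /I0 ->].
  by rewrite subr0.
apply: contraPP => /eqP xn0 Ix.
pose D (B : R^o -> Prop) := exists b y, [/\ B b, I y & (b : R) * y != 0].
have [|B [sB [b [y0 [Bb Iy0 by0]]] minB]] := dcc_min (C := D) dR.
  by exists (fun=> True); split=> //; exists 1, x; rewrite mul1r.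
(* If r b I is nonzero, the ideal R r b lies in [B] and still does not annihilate I, so by
   minimality it contains b. *)
have regen (r : R) : (exists2 y, I y & r * b * y != 0) -> exists s : R, b = s * r * b.
  move=> [y Iy rby].
  have : exists s : R^o, b = s *: ((r : R) * b : R^o).
    apply: (minB (fun z => exists s : R^o, z = s *: ((r : R) * b : R^o))) => //.
    - split=> [|a _ _ [s ->] [t ->]]; first by exists 0; rewrite scale0r.
      by exists (a * s + t); rewrite scalerDl scalerA.
    - by exists (r * b), y; split=> //; exists 1; rewrite scale1r.
    - move=> _ [s ->]; apply: subZ => //.
      exact: (subZ sB r Bb).
  by move=> [s bE]; exists s; rewrite {1}bE; exact: mulrA.
have [||W [sW _ Wx maxW]] := max_avoiding (P := fun z : R^o => z = 0) (x := b * y0).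
- by split=> [//|a u v -> ->]; rewrite scaler0 addr0.
- exact/eqP.
(* Modulo [W], every b z is a multiple of b y0: for b z outside [W], maximality gives b y0 = c b z
   modulo [W], and [regen] inverts c. *)
have Wgen z : I z -> exists2 t : R, W (b * z - t * (b * y0)) & True.
  move=> Iz; have [Wz|/maxW[c Wc]] := pselect (W (b * z)).
    by exists 0; rewrite // mul0r subr0.
  have [|s bE] := regen c.
    exists z => //; apply/eqP => cbz; apply: Wx; move: Wc.
    by rewrite -[c *: _]/(c * _ : R) mulrA cbz subr0.
  exists s => //; have -> : b * z - s * (b * y0) = (- s : R) *: (b * y0 - c *: (b * z : R^o) : R^o).
    rewrite -![_ *: _]/(_ * _ : R) {1}bE mulrBr !mulNr opprK addrC.
    by rewrite !mulrA.
  exact: subZ.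
pose I' y := I y /\ W (b * y).
have sI' : is_submod I'.
  apply: is_submodI => //; split=> [|a u v Wu Wv].
    by rewrite mulr0; exact: sub0.
  rewrite mulrDr -[a *: u]/((a : R) * u : R) mulrCA.
  exact: (subL sW a Wu Wv).
(* [I'] omits y0 because b y0 is outside [W], so R/I' being noetherian as well contradicts the
   minimality of [I]. *)
suff: forall y, I y -> I' y by move=> /(_ _ Iy0)[].
apply: minI => // [P sP|y []//].
have [s [sP' Ps]] := CI P sP.
(* Since I/I' is simple, the generators modulo [I] need at most one more element, taken in the part
   of [P] lying in [I] but not in [I']. *)
have [[y [Py Iy Wy]]|noy] := pselect (exists y, [/\ P y, I y & ~ W (b * y)]); last first.
  exists s; split=> // z Pz; have [i Ii sz] := Ps z Pz; exists i => //.
  split=> //; apply: contrapT => Wi; apply: noy; exists i; split=> //.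
  rewrite -[i](subKr z); apply: subB => //; exact: inspan_sub sz.
have [a Wa] := maxW _ Wy.
exists (y :: s); split=> [z|z Pz].
  by rewrite inE => /orP[/eqP ->//|/sP'].
have [i Ii sz] := Ps z Pz; have [t Wt _] := Wgen i Ii.
exists (i - (t * a : R) *: y); last first.
  by exists (t * a); rewrite opprB addrA addrAC addrK.
split; first by apply: subB => //; exact: subZ.
have -> : b * (i - (t * a : R) *: y) =
    t *: (b * y0 - a *: (b * y : R^o) : R^o) + (b * i - t * (b * y0)) :> R^o.
  rewrite -![_ *: _]/(_ * _ : R) !mulrBr [RHS]addrC addrA subrK.
  by rewrite mulrCA !mulrA.
exact: subL.
Qed.
End Hopkins.

(** * Restriction of scalars along a ring morphism *)

Section Restriction.
Variables (R A : pzRingType) (phi : {rmorphism R -> A}).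

(* The phantom argument phi determines the action of R on M. *)
Definition restr & {rmorphism R -> A} := fun M : lmodType A => (M : Type).

Section Instance.
Variable M : lmodType A.
Local Notation rM := (restr phi M).
HB.instance Definition _ := GRing.Zmodule.on rM.
Definition rscale (r : R) (x : rM) : rM := phi r *: (x : M).
Fact rscaleA a b x : rscale a (rscale b x) = rscale (a * b) x.
Proof. by rewrite /rscale scalerA rmorphM. Qed.
Fact rscale1 x : rscale 1 x = x.
Proof. by rewrite /rscale rmorph1 scale1r. Qed.
Fact rscaleDr a x y : rscale a (x + y) = rscale a x + rscale a y.
Proof. exact: scalerDr. Qed.
Fact rscaleDl x a b : rscale (a + b) x = rscale a x + rscale b x.
Proof. by rewrite /rscale rmorphD scalerDl. Qed.
HB.instance Definition _ := GRing.Zmodule_isLmodule.Build R rM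
  rscaleA rscale1 rscaleDr rscaleDl.
Lemma restrZ (r : R) (x : rM) : r *: x = phi r *: (x : M) :> M.
Proof. by []. Qed.
End Instance.

Lemma is_submod_restr (M : lmodType A) (P : M -> Prop) :
  is_submod P -> is_submod (P : restr phi M -> Prop).
Proof. by move=> [P0 PL]; split=> // a x y; exact: PL. Qed.

Lemma inspan_restr (M : lmodType A) (s : seq M) x :
  inspan (s : seq (restr phi M)) x -> inspan s x.
Proof. by elim: s x => [|y s IH] x //= [a /IH]; exists (phi a). Qed.

Lemma fg_of_restr (M : lmodType A) :
  finitely_generated (restr phi M) -> finitely_generated M.
Proof.
move=> /fg_inspan[s sM]; apply/fg_inspan; exists s => x.
exact/inspan_restr/sM.
Qed.

Lemma dcc_of_restr (M : lmodType A) : dcc (restr phi M) -> dcc M.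
Proof. by move=> dM I sI; apply: dM => n; exact/is_submod_restr/sI. Qed.

Lemma noetherian_of_restr (M : lmodType A) : noetherian (restr phi M) -> noetherian M.
Proof.
move=> nM P /is_submod_restr/nM[s [sP Ps]]; exists s; split=> // x /Ps.
exact: inspan_restr.
Qed.

(** The products of R-generators of A with A-generators of M generate M over R. *)
Lemma fg_restr (M : lmodType A) :
  finitely_generated (restr phi A^o) -> (forall r a, phi r * a = a * phi r) ->
  finitely_generated M -> finitely_generated (restr phi M).
Proof.
move=> /fg_inspan[t tA] central /fg_inspan[s sM].
apply/fg_inspan; exists [seq (a : A) *: x | x <- s, a <- t] => x.
elim: s x {sM} (sM x) => [|y s IH] x /=; first by [].
move=> [a /IH sx]; rewrite -(subrK (a *: y) x).
apply: (subD (is_submod_inspan _)); last first.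
  apply: (@inspan_incl _ (restr phi M) [seq (b : A) *: y | b <- t]) => [z zt|].
    by rewrite mem_cat zt.
  have hL : linear ((fun b : A => b *: y) : restr phi A^o -> restr phi M).
    by move=> c u v; rewrite !restrZ scalerDl -scalerA.
  exact: (inspan_map (mklin hL)).
by apply: inspan_incl sx => z zs; rewrite mem_cat zs orbT.
Qed.
End Restriction.

(** * Finitely generated torsion modules *)

Section Artin.
Variable A : pzRingType.

(** Submodules over A are submodules over the artinian ring R, over which M is still finitely
    generated. *)
Lemma artin_fg_noetherian (M : lmodType A) :
  artin_algebra A -> finitely_generated M -> noetherian M.
Proof.
move=> [R [phi [aR central [s sA]]]] fM; apply: (noetherian_of_restr (phi := phi)).
apply: noetherian_of_fg; first exact: artinian_noetherian.
by apply: fg_restr => //; exists s.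
Qed.

Lemma artin_fg_dcc (M : lmodType A) :
  artin_algebra A -> finitely_generated M -> dcc M.
Proof.
move=> [R [phi [aR central [s sA]]]] fM; apply: (dcc_of_restr (phi := phi)).
apply: dcc_of_fg; first exact: artinian_dcc.
by apply: fg_restr => //; exists s.
Qed.

Lemma artin_fg_submod (M : lmodType A) (N : submodClosed M) :
  artin_algebra A -> finitely_generated M -> finitely_generated (submod N).
Proof.
move=> aA /(artin_fg_noetherian aA) nM.
exact/fg_subE/nM/is_submod_mem.
Qed.

Lemma finite_pdim_submodE (U V : lmodType A) (h : {linear U -> V}) (N : submodClosed V) :
    injective h -> (forall y, y \in N <-> exists u, h u = y) ->
  finite_pdim (submod N) <-> finite_pdim U.
Proof.
move=> hi hN; have [|k hk] := factor_inj (h := h) (submod_incl_inj (N := N)).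
  by move=> w; apply/submod_inclE/hN; exists w.
have ki : injective k by move=> x y /(congr1 (submod_incl N)); rewrite !hk => /hi.
have ks : surj k.
  move=> y; have /hN[u hu] := submod_inclP y.
  by exists u; apply: submod_incl_inj; rewrite hk.
split; last exact: finite_pdim_iso ki ks.
have [j [kj jk]] := linear_inverse ki ks.
exact: (finite_pdim_retract kj).
Qed.

Definition simple (T : lmodType A) : Prop :=
  (exists t : T, t <> 0) /\ forall t : T, t <> 0 -> forall y, exists a : A, y = a *: t.

(** The annihilator of a nonzero t is a maximal left ideal, so it contains the radical. *)
Lemma jacobson_simple (T : lmodType A) (t : T) j :
  simple T -> (j : A^o) \in jacobson A -> (j : A) *: t = 0.
Proof.
move=> [_ sT] /asboolP jJ; have [->|/eqP t0] := eqVneq t 0; first exact: scaler0.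
have hL : linear ((fun a : A => a *: t) : A^o -> T).
  by move=> a x y; rewrite scalerDl scalerA.
suff /jJ/(lkernelP (mklin hL)) : maximal_left_ideal (lkernel (mklin hL)) by [].
split=> [|K sK K1 k kK]; first by apply/negP => /(lkernelP (mklin hL)) /=; rewrite scale1r.
apply/(lkernelP (mklin hL)) => /=; apply: contrapT => kt.
have [c tE] := sT _ kt t; move/negP: K1; apply.
have ckK : (1 - c * k : A^o) \in K.
  apply/sK/(lkernelP (mklin hL)) => /=.
  by rewrite scalerBl scale1r -scalerA -tE subrr.
by rewrite -(subrK (c * k) 1); apply: (rpredD (S := K)) ckK _; exact: (rpredZ c).
Qed.

Lemma jpi_eq0 (x : A) : jpi x = 0 <-> (x : A^o) \in jacobson A.
Proof. exact: quotpi_eq0. Qed.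

Lemma jpiB (x y : A) : jpi (x - y) = jpi x - jpi y.
Proof. exact: (linearB (quotpi (jacobson A))). Qed.

Fact lidealproj_subproof (f x : A) : f * f = f -> x * f * f == x * f.
Proof. by move=> ff; rewrite -mulrA ff. Qed.
Definition lidealproj (f : A) (ff : f * f = f) (x : A) : lideal f :=
  LIdeal (lidealproj_subproof x ff).

(* The component of A/J acting nontrivially on T gives a central idempotent a
   of A modulo J; with t = a t, the maps x |-> x t and b t |-> b a f exhibit T as
   a direct summand of A f / J f. *)
Lemma simple_retract (f : A) (ff : f * f = f) (T : lmodType A) :
    basic A -> simple T -> (forall t : T, f *: t = t) ->
  exists (i : {linear T -> quotmod (jlideal f)}) (r : {linear quotmod (jlideal f) -> T}),
    cancel i r.
Proof.
move=> [n [D [phi [divD phi0 phiS]]]] simT fT; have [[t0 t00] sT] := simT.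
have inJ x : (forall k, phi k (jpi x) = 0) -> (x : A^o) \in jacobson A.
  by move=> /phi0/jpi_eq0.
have Jeq x y (t : T) : (forall k, phi k (jpi x) = phi k (jpi y)) -> x *: t = y *: t.
  move=> xy; apply/eqP; rewrite -subr_eq0 -scalerBl; apply/eqP/jacobson_simple => //.
  by apply: inJ => k; rewrite jpiB rmorphB xy subrr.
have liftD d : exists x, forall k, phi k (jpi x) = d k.
  by have [u uP] := phiS d; exists (repr u); rewrite jpi_repr.
(* The [eps] lift the idempotents of the factors. Their sum is 1 modulo J, so one of them does not
   kill t0. *)
have [eps epsP] := choice (fun i => liftD (fun j => (j == i)%:R)).
have [i ei] : exists i, eps i *: t0 <> 0.
  apply: contrapT => no; apply: t00.
  rewrite -[t0]scale1r (Jeq 1 (\sum_i eps i)) ?scaler_suml.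
    by apply: big1 => i _; apply: contrapT => ei; apply: no; exists i.
  move=> k; rewrite -[jpi 1]/(1 : jquot A) rmorph1.
  rewrite [jpi _](raddf_sum (quotpi (jacobson A))) raddf_sum (bigD1 k) //=.
  rewrite [phi k _]epsP eqxx big1 ?addr0// => j jk.
  by rewrite [phi k _]epsP eq_sym (negbTE jk).
set a := eps i in ei; set t := a *: t0 in ei.
have phiM k x y : phi k (jpi (x * y)) = phi k (jpi x) * phi k (jpi y).
  by rewrite jpiM -rmorphM.
have at_ : a *: t = t.
  rewrite scalerA; apply: Jeq => k; rewrite phiM epsP.
  by case: (k == i); rewrite ?mulr1 ?mulr0.
pose G y s := exists2 b : A, y = b *: t & s = quotpi (jlideal f) (lidealproj ff (b * a)).
have [y|y|b x y x' y'|s sG] := linear_of_graph (G := G).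
- by have [b yE] := sT _ ei y; exists (quotpi (jlideal f) (lidealproj ff (b * a))), b.
- move=> [b bt ->]; apply/quotpi_eq0/asboolP; exists (b * a) => //.
  apply: inJ => k; rewrite phiM epsP.
  have [->|_] := eqVneq k i; last exact: mulr0.
  rewrite mulr1; apply/eqP/contraT => /divD[c [cb _]].
  (* [u] has component c, a left inverse of the component of b, at i and 0 elsewhere; [eq_rect]
     transports c from D i to D k. Modulo J, a = u a b, whence t = a t = u a (b t) = 0. *)
  have [u uP] := phiS (fun k => if @eqP _ i k is ReflectT ik
    then eq_rect i (fun k => D k) c k ik else 0).
  have [] : t <> 0 by [].
  rewrite -at_ (Jeq a (repr u * (a * b))); first by rewrite -!scalerA -bt !scaler0.
  move=> j; rewrite !phiM jpi_repr uP epsP.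
  case: eqP => [ij|/eqP/negbTE ij]; last by rewrite eq_sym ij !mul0r.
  by case: _ / ij; rewrite eqxx mul1r cb.
- move=> [c -> ->] [c' -> ->]; exists (b * c + c').
    by rewrite scalerDl scalerA.
  rewrite -linearP; congr quotpi; apply: val_inj => /=.
  by rewrite !mulrDl -!mulrA.
have hL : linear ((fun x : lideal f => (lideal_val x : A) *: t) : lideal f -> T).
  by move=> b x y; rewrite scalerDl scalerA.
have [||r rP] := factor_surj (g := quotpi (jlideal f)) (h := mklin hL).
- exact: quotpi_surj.
- move=> u /quotpi_eq0/asboolP[j jJ] /= ->.
  by rewrite -scalerA fT; exact: jacobson_simple.
exists s, r => y; have [b -> ->] := sG y.
by rewrite rP /= -!scalerA fT at_.
Qed.

(** Suppose M = P + A x with x outside P; a submodule that contains P and is maximal among those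
    avoiding x is then a maximal submodule. Such P and x are found by adding generators to P one at
    a time as long as the sum stays proper. *)
Lemma fg_maximal_submod (M : lmodType A) :
    finitely_generated M -> (exists x : M, x <> 0) ->
  exists W : M -> Prop, [/\ is_submod W, exists x, ~ W x &
    forall y, ~ W y -> forall x, exists a : A, W (x - a *: y)].
Proof.
move=> /fg_inspan[s sM] M0.
suff [P [x [sP Px Pgen]]] : exists (P : M -> Prop) x,
    [/\ is_submod P, ~ P x & forall y : M, exists a : A, P (y - a *: x)].
  have [W [sW PW Wx maxW]] := max_avoiding sP Px.
  exists W; split=> // [|y /maxW[a Wa] z]; first by exists x.
  have [b /PW Wb] := Pgen z; exists (b * a).
  have -> : z - (b * a) *: y = (z - b *: x) + b *: (x - a *: y).
    by rewrite scalerBr scalerA addrA subrK.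
  by apply: subD => //; exact: subZ.
have : exists P : M -> Prop, [/\ is_submod P, exists x, ~ P x &
    forall x, exists2 z, P z & inspan s (x - z)].
  exists (fun x => x = 0); split=> // [|x]; last by exists 0; rewrite ?subr0.
  by split=> // a x y -> ->; rewrite scaler0 addr0.
elim: s {sM} => [|y s IH] [P [sP [x Px] Pgen]].
  by case: Px; have [z Pz /eqP] := Pgen x; rewrite subr_eq0 => /eqP ->.
have [Qall|/existsNP[w Qw]] :=
    pselect (forall w : M, exists a : A, P (w - a *: y)).
  exists P, y; split=> // Py; apply: Px; have [a Pa] := Qall x.
  by rewrite -(subrK (a *: y) x); apply: subD => //; exact: subZ.
apply: IH; exists (fun w => exists a, P (w - a *: y)).
split; [exact: is_submod_adjoin|by exists w|move=> u].
have [z Pz [a sz]] := Pgen u; exists (z + a *: y); first by exists a; rewrite addrK.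
by rewrite opprD addrA.
Qed.

Lemma simple_quot (M : lmodType A) (W : M -> Prop) (sW : is_submod W) :
    (exists x, ~ W x) -> (forall y, ~ W y -> forall x, exists a : A, W (x - a *: y)) ->
  simple (quotmod (submod_of sW)).
Proof.
have W0 x : quotpi (submod_of sW) x = 0 <-> W x by rewrite quotpi_eq0 submod_ofP.
move=> [x Wx] maxW; split; first by exists (quotpi _ x) => /W0.
move=> t; have [y <-] := quotpi_surj t => /W0 Wy u; have [z <-] := quotpi_surj u.
have [a Wa] := maxW y Wy z; exists a.
by apply/eqP; rewrite -linearZ -subr_eq0 -linearB; apply/eqP/W0.
Qed.

(** Otherwise some submodule is minimal among those of infinite projective dimension. It has a
    maximal submodule, of finite projective dimension by minimality, and the simple quotient is
    killed by e, hence a summand of A(1 - e)/J(1 - e). *)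
Lemma torsion_finite_pdim (e : A) (T : lmodType A) :
    artin_algebra A -> basic A -> e * e = e ->
    finite_pdim (quotmod (jlideal (1 - e))) ->
    finitely_generated T -> torsion e T ->
  finite_pdim T.
Proof.
move=> aA bA ee fS fT eT; apply: contrapT => infT.
pose C (P : T -> Prop) := exists sP : is_submod P, ~ finite_pdim (submod (submod_of sP)).
have [|Y [sY [sY' infY] minY]] := dcc_min (C := C) (artin_fg_dcc aA fT).
  have sT : is_submod (fun _ : T => True) by split.
  exists (fun=> True); split=> //; exists sT => fsT; apply: infT.
  apply/(finite_pdim_submodE (h := idfun) (N := submod_of sT)) => // y.
  by split=> _; [exists y|exact/submod_ofP].
set N := submod (submod_of sY') in infY.
have fN : finitely_generated N by exact: artin_fg_submod.
have [|W [sW [x Wx] maxW]] := fg_maximal_submod fN.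
  by apply: contrapT => N0; apply: infY; apply: finite_pdim_trivial => x;
     apply: contrapT => x0; apply: N0; exists x.
apply: infY; apply: (finite_pdim_ext (ses_quot (submod_of sW))).
  pose i : {linear N -> T} := submod_incl (submod_of sY').
  have ii : injective i by exact: submod_incl_inj.
  (* Minimality concerns submodules of [T], so [W] is moved there along [i]. *)
  have sV := is_submod_image i sW; apply: contrapT => infW.
  have : forall y, Y y -> exists2 w, W w & i w = y.
    apply: minY => [//||y [w _ <-]]; last exact/submod_ofP/submod_inclP.
    exists sV => fV; apply: infW.
    have [u v /ii/submod_incl_inj//|y|fE _] := finite_pdim_submodE
        (h := i \o submod_incl (submod_of sW)) (N := submod_of sV); last exact: fE.
    split=> [/submod_ofP[w Ww <-]|[u <-]]; last first.
      by apply/submod_ofP; exists (submod_incl _ u) => //; exact/submod_ofP/submod_inclP.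
    by have [|u <-] := submod_inclE (N := submod_of sW) (x := w);
      [exact/submod_ofP|exists u].
  move=> /(_ (i x)) [|w Ww /ii wx]; first exact/submod_ofP/submod_inclP.
  by apply: Wx; rewrite -wx.
have ff : (1 - e) * (1 - e) = 1 - e.
  by rewrite mulrBr mulr1 mulrBl mul1r ee subrr subr0.
have simT := simple_quot sW (ex_intro _ x Wx) maxW.
have [|i [r ir]] := simple_retract ff bA simT; last exact: finite_pdim_retract ir fS.
move=> t; have [y <-] := quotpi_surj t; rewrite -linearZ; congr quotpi.
apply: submod_incl_inj; rewrite linearZ /= scalerBl scale1r.
by rewrite (eT (submod_incl _ y)) subr0.
Qed.
End Artin.

(** * The corner functor and its left adjoint *)

(** The cover is built by adding one copy of A for each generator. The property [T] carries along
    whatever else is to be known about it. *)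
Lemma fg_cover (A : pzRingType) (T : lmodType A -> Prop) (M : lmodType A) :
    (forall P : lmodType A, (forall x : P, x = 0) -> T P) ->
    (forall P : lmodType A, T P -> T (A^o * P)%type) ->
    finitely_generated M ->
  exists (P : lmodType A) (g : {linear P -> M}),
    [/\ surj g, projective P, finitely_generated P & T P].
Proof.
move=> T0 TA /fg_inspan[s sM].
suff [P [g [gs pP fP tP]]] : exists (P : lmodType A) (g : {linear P -> M}),
    [/\ forall x, inspan s x -> exists p, g p = x, projective P,
        finitely_generated P & T P].
  by exists P, g; split=> // x; exact/gs/sM.
elim: s {sM} => [|y s [P [g [gs pP fP tP]]]].
  have Z0 (x : submod (lkernel (idfun : {linear A^o -> A^o}))) : x = 0.
    by apply: submod_incl_inj; rewrite linear0; exact/(lkernelP idfun)/submod_inclP.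
  exists (submod (lkernel (idfun : {linear A^o -> A^o}))), \0; split=> [x -> /=||| ].
  - by exists 0.
  - exact: proj_trivial.
  - by apply/fg_inspan; exists [::] => x; exact: Z0.
  - exact: T0.
have hL : linear ((fun a : A => a *: y) : A^o -> M).
  by move=> a u v; rewrite scalerDl scalerA.
exists (A^o * P)%type, (lsum (mklin hL) g); split.
- move=> x [a /gs[p gp]]; exists (a : A^o, p).
  by rewrite /= gp addrC subrK.
- by apply: proj_prod => //; exact: proj_ring.
- by apply: fg_prod => //; exact: fg_ring.
- exact: TA.
Qed.

Section CornerFunctor.
Variables (A : pzRingType) (e : A) (he : e * e = e).
Local Notation eAe := (corner he).
Local Notation cm M := (cornermod M he).

Lemma cornermodE (M : lmodType A) (x : M) : e *: x = x -> exists y : cm M, val y = x.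
Proof. by move=> /eqP ex; exists (CornerMod he ex). Qed.

Lemma corner_idem (M : lmodType A) (x : M) : e *: (e *: x) = e *: x.
Proof. by rewrite scalerA he. Qed.

Lemma cornermap_inj (M N : lmodType A) (p : {linear M -> N}) :
  injective p -> injective (cornermap he p).
Proof. by move=> ip x y /(congr1 val)/ip/val_inj. Qed.

Lemma cornermap_surj (M N : lmodType A) (p : {linear M -> N}) :
  surj p -> surj (cornermap he p).
Proof.
move=> ps y; have [x px] := ps (val y); have [w wE] := cornermodE (corner_idem x).
by exists w; apply: val_inj; rewrite /= wE linearZ px; exact: cornermodP.
Qed.

(** Surjectivity is asked on corners only, so that the lemma serves for maps whose cokernel is
    killed by e, such as [adjoint q] with [q] surjective. *)
Lemma ses_corner_of_surj (K M N : lmodType A) (i : {linear K -> M}) (p : {linear M -> N}) :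
    injective i -> (forall x, p x = 0 <-> exists k, i k = x) ->
    surj (cornermap he p) ->
  ses (cornermap he i) (cornermap he p).
Proof.
move=> ii ip ps; split=> // [|x]; first exact: cornermap_inj.
split=> [/(congr1 val)/= /ip[k ik]|[k <-]]; last first.
  by apply: val_inj => /=; apply/ip; exists (val k).
have [w wE] := cornermodE (corner_idem k).
by exists w; apply: val_inj; rewrite /= wE linearZ ik; exact: cornermodP.
Qed.

Lemma ses_corner (K M N : lmodType A) (i : {linear K -> M}) (p : {linear M -> N}) :
  ses i p -> ses (cornermap he i) (cornermap he p).
Proof. by move=> [ii ps ip]; apply: ses_corner_of_surj => //; exact: cornermap_surj. Qed.

Fact lideal1_subproof : e * e == e. Proof. exact/eqP. Qed.
Definition lideal1 : lideal e := LIdeal lideal1_subproof.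

Fact to_corner_subproof (a : A) : e * (e * a * e) * e == e * a * e.
Proof. by rewrite !mulrA he -mulrA he. Qed.
Definition to_corner (a : A) : eAe := Corner he (to_corner_subproof a).

(** * The unit isomorphism from X to e(Ae (x) X) *)

Section TensorUnit.
Variable X : lmodType eAe.

Lemma tens1Z (c : eAe) (x : X) :
  tens lideal1 (c *: x) = (val c : A) *: tens lideal1 x :> tensor X.
Proof.
have [_ _ bM] := tens_balanced X; rewrite -bM scale_tens; congr tens.
by apply: val_inj; exact: etrans (corner_mull c) (esym (corner_mulr c)).
Qed.

Lemma tensE (a : lideal e) (x : X) :
  tens a x = (lideal_val a : A) *: tens lideal1 x.
Proof.
by rewrite scale_tens; congr tens; apply: val_inj; rewrite /= [RHS]lidealP.
Qed.

Lemma tens1_corner (x : X) : e *: tens lideal1 x == tens lideal1 x.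
Proof. by rewrite -[X in X *: _]/(lideal_val lideal1 : A) -tensE. Qed.
Definition tensor_unit_fun (x : X) : cm (tensor X) := CornerMod he (tens1_corner x).

Fact tensor_unit_linear : linear tensor_unit_fun.
Proof.
have [_ bDr _] := tens_balanced X.
by move=> c x y; apply: val_inj; rewrite /= bDr tens1Z.
Qed.
Definition tensor_unit := mklin tensor_unit_linear.

(** Multiplication by e followed by the identification of e(Ae (x) X) with X; on the corner it
    inverts [tensor_unit]. *)
Definition tensor_retract (t : tensor X) : X :=
  tensor_lift (fun a x => to_corner (lideal_val a) *: x) t.

Fact tensor_retract_balanced :
  balanced (fun (a : lideal e) (x : X) => to_corner (lideal_val a) *: x).
Proof.
split=> [a a' x|a x y|a c x]; rewrite ?scalerDr// ?scalerA -?scalerDl;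
  congr (_ *: _); apply: val_inj => /=.
  by rewrite mulrDr mulrDl.
by rewrite -!mulrA corner_mulr corner_mull.
Qed.

Lemma tensor_unitK : cancel tensor_unit (fun y => tensor_retract (val y)).
Proof.
move=> x; rewrite /= /tensor_retract tensor_lift_tens; last exact: tensor_retract_balanced.
by rewrite -[RHS]scale1r; congr (_ *: _); apply: val_inj; rewrite /= he.
Qed.

Lemma tensor_unit_inj : injective tensor_unit.
Proof. exact: can_inj tensor_unitK. Qed.

Lemma tensor_unit_retract (t : tensor X) :
  e *: t = val (tensor_unit (tensor_retract t)).
Proof.
have tD := tensor_liftD (b := fun a x => to_corner (lideal_val a) *: x) _ _
  tensor_retract_balanced.
have t0 : tensor_retract 0 = 0.
  by apply: (addIr (tensor_retract 0)); rewrite /tensor_retract -tD !add0r.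
apply: (tensor_ext (f := fun t => e *: t)
  (g := fun t => val (tensor_unit (tensor_retract t)))) => [||u v|u v|a x].
- exact: scaler0.
- by rewrite t0 linear0.
- exact: scalerDr.
- by rewrite /tensor_retract tD linearD.
rewrite /tensor_retract tensor_lift_tens; last exact: tensor_retract_balanced.
rewrite /= tens1Z tensE scalerA; congr (_ *: _) => /=.
by rewrite -mulrA lidealP.
Qed.

Lemma tensor_unit_surj : surj tensor_unit.
Proof.
move=> y; exists (tensor_retract (val y)); apply: val_inj.
by rewrite -tensor_unit_retract cornermodP.
Qed.

(** By [tensE] every elementary tensor is a multiple of one whose first factor is e, so e (x) s
    generate when s runs over generators of X. *)
Lemma fg_tensor : finitely_generated X -> finitely_generated (tensor X).
Proof.
have [_ bDr _] := tens_balanced X.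
have t0 : tens lideal1 0 = 0 :> tensor X.
  by apply: (addIr (tens lideal1 0)); rewrite -bDr !add0r.
move=> /fg_inspan[s sX]; apply/fg_inspan; exists (map (tens lideal1) s) => t.
have sS := is_submod_inspan (map (tens lideal1) s).
have s1 r x : inspan r x -> inspan (map (tens lideal1) r) (tens lideal1 x : tensor X).
  elim: r x => [|y r IH] x /=; first by move=> ->; exact: t0.
  move=> [c /IH rx]; exists (val c); rewrite -tens1Z.
  by rewrite -[x](subrK (c *: y)) bDr addrK.
rewrite -(tclass_repr t); elim: (repr t) => [|[a x] r IH]; first exact: (sub0 sS).
by rewrite tclass_cons tensE; apply: (subL sS) => //; exact/s1/sX.
Qed.

End TensorUnit.

Section Adjoint.
Variables (X : lmodType eAe) (F : lmodType A) (q : {linear X -> cm F}).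

Definition adjoint : {linear tensor X -> F} := tensor_eps he F \o tensor_map q.

Lemma adjoint_tens a x : adjoint (tens a x) = (lideal_val a : A) *: val (q x).
Proof.
rewrite /= /tensor_map tensor_lift_tens; last exact: tensor_map_balanced.
by rewrite /tensor_eps tensor_lift_tens //; exact: tensor_eps_balanced.
Qed.

Lemma adjoint_unit x : adjoint (val (tensor_unit X x)) = val (q x).
Proof. by rewrite [LHS]adjoint_tens /= cornermodP. Qed.

Lemma cornermap_adjoint_unit x : cornermap he adjoint (tensor_unit X x) = q x.
Proof. by apply: val_inj; rewrite [LHS]adjoint_unit. Qed.
End Adjoint.

Lemma tensor_lin_ext (X : lmodType eAe) (F : lmodType A) (f g : {linear tensor X -> F}) :
  (forall x, f (tens lideal1 x) = g (tens lideal1 x)) -> f =1 g.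
Proof.
move=> fg; apply: tensor_ext => [||||a x]; rewrite ?linear0//.
- exact: linearD.
- exact: linearD.
by rewrite tensE !linearZ fg.
Qed.

(** Tensoring with A e is left adjoint to the exact functor M |-> eM: a lift is found on corners and
    transposed by [adjoint]. *)
Lemma proj_tensor (Q : lmodType eAe) : projective Q -> projective (tensor Q).
Proof.
move=> pQ M N g f gs.
have [h gh] := pQ _ _ (cornermap he g) (cornermap he f \o tensor_unit Q) (cornermap_surj gs).
exists (adjoint h); apply: (@tensor_lin_ext _ _ (g \o adjoint h) f) => x.
rewrite -[tens _ _]/(val (tensor_unit Q x)) [LHS](congr1 g (adjoint_unit h x)).
exact: (congr1 val (gh x)).
Qed.

Section CornerMorphism.
Variables (R : comPzRingType) (phi : {rmorphism R -> A}).
Hypothesis central : forall r a, phi r * a = a * phi r.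

(** The structure map of eAe as an R-algebra. Centrality is an argument so that the morphism
    instances can be inferred from the term. *)
Definition corner_morph_fun & (forall r a, phi r * a = a * phi r) :=
  fun r => to_corner (phi r).

Fact corner_morph_additive : zmod_morphism (corner_morph_fun central).
Proof. by move=> r s; apply: val_inj; rewrite /= rmorphB mulrBr mulrBl. Qed.
Fact corner_morph_multiplicative : monoid_morphism (corner_morph_fun central).
Proof.
split=> [|r s]; apply: val_inj; rewrite /= ?rmorph1 ?mulr1 ?he// rmorphM.
rewrite !mulrA -(mulrA _ e e) he -(mulrA _ e (phi s)) -(central s e).
by rewrite !mulrA -(mulrA _ e e) he.
Qed.
HB.instance Definition _ := GRing.isZmodMorphism.Build R eAe
  (corner_morph_fun central) corner_morph_additive.
HB.instance Definition _ := GRing.isMonoidMorphism.Build R eAe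
  (corner_morph_fun central) corner_morph_multiplicative.
Definition corner_morph : {rmorphism R -> eAe} := corner_morph_fun central.

Lemma corner_morphZ (M : lmodType A) (r : R) (x : cm M) :
  val (corner_morph r *: x) = phi r *: val x.
Proof.
rewrite -[LHS]/((e * phi r * e) *: val x) -!scalerA cornermodP scalerA -central.
by rewrite -scalerA cornermodP.
Qed.

Lemma corner_morph_central r (c : eAe) : corner_morph r * c = c * corner_morph r.
Proof.
apply: val_inj; rewrite -[LHS]/(e * phi r * e * val c) -[RHS]/(val c * (e * phi r * e)).
rewrite -mulrA corner_mull -(central r e) -mulrA corner_mull.
by rewrite -mulrA he (central r e) mulrA corner_mulr central.
Qed.

Lemma fg_restr_corner (M : lmodType A) :
  finitely_generated (restr phi M) -> finitely_generated (restr corner_morph (cm M)).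
Proof.
pose h (x : restr phi M) : restr corner_morph (cm M) :=
  CornerMod he (introT eqP (corner_idem (x : M))).
have hL : linear h.
  move=> r x y; apply: val_inj.
  rewrite -[RHS]/(val (corner_morph r *: (h x : cm M)) + val (h y)) corner_morphZ.
  by rewrite /= scalerDr restrZ !scalerA central.
apply: (fg_surj (g := mklin hL)) => y; exists (val y).
by apply: val_inj; exact: cornermodP.
Qed.

Lemma fg_restr_corner_ring :
  finitely_generated (restr phi A^o) -> finitely_generated (restr corner_morph eAe^o).
Proof.
have hL : linear (to_corner : restr phi A^o -> restr corner_morph eAe^o).
  move=> r x y; apply: val_inj; rewrite /= restrZ mulrDr mulrDl; congr (_ + _).
  by rewrite -[phi r *: _]/(phi r * (x : A)) -(central r e) -(mulrA _ e e) he
    -!mulrA (mulrA e e) he (mulrA e (phi r)) -(central r e) -mulrA.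
apply: (fg_surj (g := mklin hL)) => y; exists (val y).
by apply: val_inj; exact: cornerP.
Qed.
End CornerMorphism.

(** Since R acts centrally, x |-> e x presents eM as an R-linear quotient of M. *)
Lemma fg_corner (M : lmodType A) :
  artin_algebra A -> finitely_generated M -> finitely_generated (cm M).
Proof.
move=> [R [phi [aR central fA]]] fM; apply: (fg_of_restr (phi := corner_morph central)).
exact/fg_restr_corner/fg_restr.
Qed.
End CornerFunctor.

(** * Finite projective dimension and corners *)

Section CornerDimension.
Variables (A : pzRingType) (e : A) (he : e * e = e).
Local Notation eAe := (corner he).
Local Notation cm M := (cornermod M he).
Hypothesis (aA : artin_algebra A).

Lemma cornermod_trivial (M : lmodType A) : (forall x : M, x = 0) -> forall x : cm M, x = 0.
Proof. by move=> M0 x; apply: val_inj; rewrite /= [LHS]M0. Qed.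

(** Right multiplication by e maps eA onto eAe with kernel eA(1 - e), and eAe is projective over
    itself. *)
Lemma finite_pdim_corner_ring :
  finite_pdim (cm (lideal (1 - e))) -> finite_pdim (cm A^o).
Proof.
have iL : linear (@lideal_val A (1 - e)) by [].
have pL : linear ((fun x => to_corner he (val x)) : cm A^o -> eAe^o).
  move=> c x y; apply: val_inj => /=.
  rewrite mulrDr mulrDl; congr (_ + _).
  have ce := corner_mull c; rewrite /= in ce.
  rewrite -[_ *: _]/(corner_val c * (cornermod_val x : A)) mulrA ce.
  have ex : e * (cornermod_val x : A) = cornermod_val x := cornermodP x.
  by rewrite ex mulrA.
move=> fl; apply: (finite_pdim_ext (i := cornermap he (mklin iL)) (p := mklin pL)) fl _.
  split; first by apply: cornermap_inj; exact: val_inj.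
    move=> y; have [|x xE] := cornermodE he (M := A^o) (x := (val y : A)).
      exact: (corner_mull y).
    by exists x; apply: val_inj; rewrite /= [cornermod_val _]xE; exact: cornerP.
  move=> x; have ex : e * (val x : A) = val x := cornermodP x.
  split=> [/(congr1 val) /= xe0|[k <-]]; last first.
    apply: val_inj => /=; set l := cornermod_val k.
    have le : lideal_val l * (1 - e) = lideal_val l := lidealP l.
    by rewrite -le -!mulrA mulrBl mul1r he subrr !mulr0.
  have le : (val x : A) * (1 - e) == val x.
    have xe : (val x : A) * e = 0 by rewrite -ex; exact: xe0.
    by rewrite mulrBr mulr1 xe subr0.
  have el : e *: (LIdeal le : lideal (1 - e)) == LIdeal le.
    by apply/eqP; apply: val_inj; exact: ex.
  by exists (CornerMod he el); apply: val_inj.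
exact/projective_finite_pdim/proj_ring.
Qed.

Hypothesis (hl : finite_pdim (cm (lideal (1 - e)))).

Lemma fg_cover_corner (M : lmodType A) :
  finitely_generated M ->
  exists (P : lmodType A) (g : {linear P -> M}),
    [/\ surj g, projective P, finitely_generated P & finite_pdim (cm P)].
Proof.
move=> fM; apply: (fg_cover (T := fun P => finite_pdim (cm P))) => // P.
  by move=> P0; exact/finite_pdim_trivial/cornermod_trivial.
apply: finite_pdim_ext (ses_corner he (ses_prod A^o P)) _.
exact: finite_pdim_corner_ring.
Qed.

(** Induction along syzygies of covers with corners of finite projective dimension: taking corners
    is exact, and a projective M is a summand of its cover. *)
Lemma finite_pdim_corner (M : lmodType A) :
  finitely_generated M -> finite_pdim M -> finite_pdim (cm M).
Proof.
move=> fM /finite_pdim_pd[n]; elim: n M fM => [|n IH] M fM Mn;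
  have [P [g [gs pP fP eP]]] := fg_cover_corner fM.
  have [s sg] := proj_split Mn gs.
  apply: (finite_pdim_retract (i := cornermap he s) (r := cornermap he g)) eP.
  by move=> x; apply: val_inj; rewrite /= sg.
have K := ses_ker gs; apply: (finite_pdim_coker (ses_corner he K)) eP.
apply: IH; first exact: artin_fg_submod.
exact: (pd_syzygy K pP Mn).
Qed.

Hypothesis (bA : basic A) (hS : finite_pdim (quotmod (jlideal (1 - e)))).

(** The image of g is P modulo the kernel. The cokernel is killed by e because g is onto on corners,
    so [torsion_finite_pdim] applies to it. *)
Lemma finite_pdim_of_corner_surj (P M : lmodType A) (g : {linear P -> M}) :
    finitely_generated M -> surj (cornermap he g) ->
    finite_pdim P -> finite_pdim (submod (lkernel g)) -> finite_pdim M.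
Proof.
move=> fM gs fP fK.
have [|c cE] := factor_inj (h := g) (submod_incl_inj (N := lrange g)).
  by move=> w; apply/submod_inclE/asboolP; exists w.
have cs : surj c.
  move=> y; have /asboolP[x gx] := submod_inclP y.
  by exists x; apply: submod_incl_inj; rewrite cE.
have cK : ses (submod_incl (lkernel g)) c.
  split=> // [|x]; first exact: submod_incl_inj.
  split=> [cx|[k <-]].
    by apply/submod_inclE/(lkernelP g); rewrite -cE cx linear0.
  by apply: submod_incl_inj; rewrite cE linear0; exact/(lkernelP g)/submod_inclP.
apply: (finite_pdim_ext (ses_quot (lrange g))).
  exact: finite_pdim_coker cK fK fP.
apply: (torsion_finite_pdim (e := e)) => //.
  exact: fg_surj (@quotpi_surj _ _ (lrange g)) fM.
move=> y; have [x <-] := quotpi_surj y; rewrite -linearZ; apply/quotpi_eq0/asboolP.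
have [w wE] := cornermodE he (corner_idem he x); have [z gz] := gs w.
by exists (val z); rewrite -wE -gz.
Qed.

(** If eM is projective, so is Ae (x) eM, and its map to M has kernel and cokernel killed by e.
    Otherwise eM is covered by a projective Q, and the kernel of Ae (x) Q -> M has a syzygy of eM as
    its corner. *)
Lemma finite_pdim_of_corner (M : lmodType A) :
  finitely_generated M -> finite_pdim (cm M) -> finite_pdim M.
Proof.
move=> fM /finite_pdim_pd[n]; elim: n M fM => [|n IH] M fM Mn.
  pose g := adjoint (idfun : {linear cm M -> cm M}).
  have fT := fg_tensor (fg_corner he aA fM).
  have fK := artin_fg_submod (lkernel g) aA fT.
  apply: (@finite_pdim_of_corner_surj (tensor (cm M)) M g) => //.
  - by move=> y; exists (tensor_unit _ y); exact: cornermap_adjoint_unit.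
  - exact/projective_finite_pdim/proj_tensor.
  (* The element e k is the unit at some x of eM. Its image under [g] is x on the one hand and e
     g(k) = 0 on the other. *)
  apply: (torsion_finite_pdim (e := e)) => // k; apply: submod_incl_inj.
  have /(lkernelP g) gk := submod_inclP k.
  rewrite linearZ linear0 [LHS]tensor_unit_retract.
  have /(congr1 g) := tensor_unit_retract (submod_incl _ k).
  rewrite linearZ gk [RHS](adjoint_unit (idfun : {linear cm M -> cm M})).
  rewrite [LHS]scaler0 => /esym r0.
  by rewrite (_ : tensor_retract _ = 0) ?linear0//; apply: val_inj.
have [|||Q [q [qs pQ fQ _]]] := @fg_cover _ (fun=> True) (cm M).
- by [].
- by [].
- exact: fg_corner.
have gs : surj (cornermap he (adjoint q)).
  move=> y; have [x <-] := qs y; exists (tensor_unit _ x).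
  exact: cornermap_adjoint_unit.
have fT := fg_tensor fQ.
apply: (finite_pdim_of_corner_surj fM gs).
  exact/projective_finite_pdim/proj_tensor.
apply: IH; first exact: artin_fg_submod.
have K : ses (cornermap he (submod_incl (lkernel (adjoint q)))) (cornermap he (adjoint q)).
  apply: ses_corner_of_surj => // [|x]; first exact: submod_incl_inj.
  split=> [/(lkernelP (adjoint q))/submod_inclE//|[k <-]].
  exact/(lkernelP (adjoint q))/submod_inclP.
apply: pd_syzygy K _ Mn.
have [j [uj ju]] := linear_inverse (@tensor_unit_inj _ _ _ Q) (@tensor_unit_surj _ _ _ Q).
exact: proj_retract ju pQ.
Qed.

Lemma Pfin_corner (M : lmodType A) : Pfin M -> Pfin (cm M).
Proof.
by move=> [fM pM]; split; [exact: fg_corner|exact: finite_pdim_corner].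
Qed.

Lemma Pfin_of_corner (M : lmodType A) :
  finitely_generated M -> Pfin (cm M) -> Pfin M.
Proof. by move=> fM [_ pM]; split=> //; exact: finite_pdim_of_corner. Qed.

Lemma Pfin_iso (B : pzRingType) (M N : lmodType B) (h : {linear M -> N}) :
  injective h -> surj h -> Pfin M -> Pfin N.
Proof.
move=> hi hs [fM pM]; split; first exact: fg_surj hs fM.
exact: finite_pdim_iso hi hs pM.
Qed.

Lemma Pfin_tensor (X : lmodType eAe) : Pfin X -> Pfin (tensor X).
Proof.
move=> pX; apply: Pfin_of_corner; first by apply: fg_tensor; case: pX.
exact: Pfin_iso (@tensor_unit_inj _ _ _ X) (@tensor_unit_surj _ _ _ X) pX.
Qed.
End CornerDimension.

(** * The coextension of a map into a corner *)

Section Coextension.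
Variables (A : pzRingType) (e : A) (he : e * e = e).
Local Notation eAe := (corner he).
Local Notation cm M := (cornermod M he).
Variables (X : lmodType eAe) (F : lmodType A) (q : {linear X -> cm F}).

(* The pullback of Hom_{eAe}(eA, X) -> Hom_{eAe}(eA, eF) <- F; a homomorphism
   from e A is extended to A by f(a) = f(e a). *)
Record coext := Coext {
  coext_fun : A -> X;
  coext_pt : F;
  coextD : forall a b, coext_fun (a + b) = coext_fun a + coext_fun b;
  coextM : forall (c : eAe) a, coext_fun (val c * a) = c *: coext_fun a;
  coextq : forall a, val (q (coext_fun a)) = e *: (a *: coext_pt) }.
HB.instance Definition _ := gen_eqMixin coext.
HB.instance Definition _ := gen_choiceMixin coext.

Lemma coext_eq u v :
  (forall a, coext_fun u a = coext_fun v a) -> coext_pt u = coext_pt v -> u = v.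
Proof.
case: u v => [f x D M Q] [f' x' D' M' Q'] /= /funext ff xx.
by subst f' x'; congr Coext; exact: Prop_irrelevance.
Qed.

Definition coext_add (u v : coext) : coext.
Proof.
exists (fun a => coext_fun u a + coext_fun v a) (coext_pt u + coext_pt v).
- by move=> a b; rewrite !coextD addrACA.
- by move=> c a; rewrite !coextM scalerDr.
- by move=> a; rewrite linearD [LHS]/= [cornermod_val _]coextq [cornermod_val _]coextq !scalerDr.
Defined.
Definition coext_opp (u : coext) : coext.
Proof.
exists (fun a => - coext_fun u a) (- coext_pt u).
- by move=> a b; rewrite coextD opprD.
- by move=> c a; rewrite coextM scalerN.
- by move=> a; rewrite linearN [LHS]/= [cornermod_val _]coextq !scalerN.
Defined.
Definition coext_zero : coext.
Proof.
exists (fun=> 0) 0 => [a b|c a|a]; rewrite ?addr0 ?scaler0//.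
by rewrite linear0.
Defined.
Definition coext_scale (c : A) (u : coext) : coext.
Proof.
exists (fun a => coext_fun u (a * c)) (c *: coext_pt u).
- by move=> a b; rewrite mulrDl coextD.
- by move=> d a; rewrite -mulrA coextM.
- by move=> a; rewrite coextq -scalerA.
Defined.

Fact coext_addA : associative coext_add.
Proof. by move=> u v w; apply: coext_eq => [a|] /=; rewrite addrA. Qed.
Fact coext_addC : commutative coext_add.
Proof. by move=> u v; apply: coext_eq => [a|] /=; rewrite addrC. Qed.
Fact coext_add0 : left_id coext_zero coext_add.
Proof. by move=> u; apply: coext_eq => [a|] /=; rewrite add0r. Qed.
Fact coext_addN : left_inverse coext_zero coext_opp coext_add.
Proof. by move=> u; apply: coext_eq => [a|] /=; rewrite addNr. Qed.
HB.instance Definition _ := GRing.isZmodule.Build coext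
  coext_addA coext_addC coext_add0 coext_addN.

Fact coext_scaleA a b u : coext_scale a (coext_scale b u) = coext_scale (a * b) u.
Proof. by apply: coext_eq => [c|] /=; rewrite ?mulrA ?scalerA. Qed.
Fact coext_scale1 u : coext_scale 1 u = u.
Proof. by apply: coext_eq => [c|] /=; rewrite ?mulr1 ?scale1r. Qed.
Fact coext_scaleDr a u v : coext_scale a (u + v) = coext_scale a u + coext_scale a v.
Proof. by apply: coext_eq => [c|] //=; rewrite scalerDr. Qed.
Fact coext_scaleDl u a b : coext_scale (a + b) u = coext_scale a u + coext_scale b u.
Proof. by apply: coext_eq => [c|] /=; rewrite ?mulrDr ?coextD ?scalerDl. Qed.
HB.instance Definition _ := GRing.Zmodule_isLmodule.Build A coext
  coext_scaleA coext_scale1 coext_scaleDr coext_scaleDl.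

Definition coext_proj : {linear coext -> F} := @mklin A coext F coext_pt (fun _ _ _ => erefl).

Lemma coext_fun1 (u : coext) a : coext_fun u (e * a) = coext_fun u a.
Proof. by rewrite (coextM u (1 : eAe)) scale1r. Qed.

Fact coext_eval_linear : linear (fun z : cm coext => coext_fun (val z) 1).
Proof.
move=> c x y; rewrite -[LHS]/(coext_fun (val x) (1 * val c) + coext_fun (val y) 1).
by rewrite mul1r -[X in coext_fun _ X]mulr1 coextM.
Qed.
Definition coext_eval : {linear cm coext -> X} := mklin coext_eval_linear.

Lemma coext_eval_compat z : q (coext_eval z) = cornermap he coext_proj z.
Proof.
apply: val_inj; rewrite [LHS]coextq scale1r.
exact: (congr1 coext_pt (cornermodP z)).
Qed.

Lemma coext_funE (u : coext) a :
  coext_fun u a = coext_eval (CornerMod he (introT eqP (corner_idem he (a *: u)))).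
Proof. by rewrite [RHS]/= mul1r coext_fun1. Qed.

(** An element fixed by e satisfies f(a) = f(a e) = (e a e) f(1), and its point in F is q(f(1)); so
    f(1) determines it. *)
Lemma coext_eval_inj : injective coext_eval.
Proof.
apply: lin_inj => z z0; apply: val_inj; apply: coext_eq => [a|]; last first.
  have /(congr1 val) := coext_eval_compat z.
  by rewrite z0 linear0.
have -> : coext_fun (val z) a = to_corner he a *: coext_eval z.
  rewrite -[RHS](coextM (val z)) mulr1 -{1}(cornermodP z).
  by rewrite [LHS]/= -coext_fun1 mulrA.
by rewrite z0 scaler0.
Qed.

Section Lift.
Variables (Y : lmodType A) (h : {linear Y -> F}) (g : {linear cm Y -> X}).
Hypothesis gh : forall y, q (g y) = cornermap he h y.

Definition corner_proj (y : Y) : cm Y := CornerMod he (introT eqP (corner_idem he y)).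

Lemma corner_projL (y : cm Y) : corner_proj (val y) = y.
Proof. by apply: val_inj; exact: cornermodP. Qed.

Lemma corner_projD x y : corner_proj (x + y) = corner_proj x + corner_proj y.
Proof. by apply: val_inj; rewrite /= scalerDr. Qed.

Lemma corner_projZ (c : eAe) y : corner_proj (val c *: y) = c *: corner_proj y.
Proof.
apply: val_inj; rewrite -[LHS]/(e *: (val c *: y)) -[RHS]/(val c *: (e *: y)).
by rewrite !scalerA corner_mull corner_mulr.
Qed.

(** The universal property of the pullback; the hypothesis [gh] supplies the compatibility
    [coextq]. *)
Definition coext_lift_fun (y : Y) : coext.
Proof.
exists (fun a => g (corner_proj (a *: y))) (h y).
- by move=> a b; rewrite scalerDl corner_projD linearD.
- by move=> c a; rewrite -scalerA corner_projZ linearZ.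
- by move=> a; rewrite gh /= !linearZ.
Defined.

Fact coext_lift_linear : linear coext_lift_fun.
Proof.
move=> c x y; apply: coext_eq => [a|] /=; last exact: linearP.
by rewrite scalerDr corner_projD linearD scalerA.
Qed.
Definition coext_lift : {linear Y -> coext} := mklin coext_lift_linear.

Lemma coext_proj_lift y : coext_proj (coext_lift y) = h y.
Proof. by []. Qed.

Lemma coext_eval_lift y : coext_eval (cornermap he coext_lift y) = g y.
Proof. by rewrite /= scale1r corner_projL. Qed.

(** An element y of the kernel satisfies e a y = 0 for every a, so it lies in Delta(Y). *)
Lemma coext_lift_inj : injective g -> torsionfree e Y -> injective coext_lift.
Proof.
move=> gi tY; apply: lin_inj => y y0; apply: tY; apply/asboolP => a.
have := congr1 (fun u => coext_fun u a) y0; rewrite /= -(linear0 g) => /gi.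
by move=> /(congr1 val); rewrite /= scalerA.
Qed.
End Lift.

Lemma coext_hom_ext (Y : lmodType A) (u v : {linear Y -> coext}) :
    (forall y, coext_proj (u y) = coext_proj (v y)) ->
    (forall y, coext_eval (cornermap he u y) = coext_eval (cornermap he v y)) ->
  u =1 v.
Proof.
move=> pu eu y; apply: coext_eq; last exact: pu.
move=> a; have := eu (corner_proj (a *: y)).
by rewrite /= !linearZ /= !mul1r !coext_fun1.
Qed.

(** The universal property is applied to Ae (x) X, whose corner is X; this yields an element with
    any prescribed value. *)
Lemma coext_eval_surj : surj coext_eval.
Proof.
have [j [uj ju]] := linear_inverse (@tensor_unit_inj _ _ he X) (@tensor_unit_surj _ _ he X).
have jq y : q (j y) = cornermap he (adjoint q) y.
  by rewrite -[y in RHS]ju cornermap_adjoint_unit.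
move=> x; exists (cornermap he (coext_lift jq) (tensor_unit X x)).
by rewrite coext_eval_lift uj.
Qed.

Lemma coext_torsionfree : torsionfree e F -> torsionfree e coext.
Proof.
move=> tF u /asboolP u0; apply: coext_eq => [a|].
  rewrite coext_funE (_ : CornerMod _ _ = 0) ?linear0//.
  by apply: val_inj; rewrite /= scalerA.
by apply: tF; apply/asboolP => a; exact: (congr1 coext_pt (u0 a)).
Qed.

(** Over R, an element is determined by its point in F and its values at finitely many R-generators
    of A. These are R-linear maps to noetherian modules, treated in turn by [fg_sub_step]. *)
Lemma coext_fg : artin_algebra A ->
  finitely_generated X -> finitely_generated F -> finitely_generated coext.
Proof.
move=> [R [phi [aR central fA]]] fX fF; pose psi := corner_morph he central.
have nR := artinian_noetherian aR.
have nF : noetherian (restr phi F) by exact/noetherian_of_fg/fg_restr.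
have nX : noetherian (restr psi X).
  apply: noetherian_of_fg => //; apply: fg_restr => //.
    exact: fg_restr_corner_ring.
  exact: corner_morph_central.
have funZ (u : coext) r a : coext_fun u (phi r * a) = psi r *: coext_fun u a.
  rewrite -coextM -coext_fun1 /= -(central r e) -(mulrA _ e e) he.
  by rewrite mulrA -central.
have evL a : linear ((fun u => coext_fun u a) : restr phi coext -> restr psi X).
  move=> r u v; rewrite -[LHS]/(coext_fun u (a * phi r) + coext_fun v a).
  by rewrite -central funZ.
have prL : linear (coext_pt : restr phi coext -> restr phi F) by [].
have [t tA] := iffLR (fg_inspan (restr phi A^o)) fA.
have fg_eval (r : seq A) (P : restr phi coext -> Prop) : is_submod P ->
    (forall u, P u -> (forall a, a \in r -> coext_fun u a = 0) -> u = 0) -> fg_sub P.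
  elim: r P => [|a r IH] P sP rP.
    by exists [::]; split=> // u Pu; exact: rP.
  apply: (fg_sub_step (g := mklin (evL a))) => //; apply: IH.
    by apply: is_submodI => //; exact: is_submod_ker.
  move=> u [Pu ua] ur; apply: rP => // b; rewrite inE => /orP[/eqP ->//|].
  exact: ur.
apply: (fg_of_restr (phi := phi)); apply: noetherian_fg => P sP.
apply: (fg_sub_step (g := mklin prL)) => //; apply: (fg_eval t).
  by apply: is_submodI => //; exact: is_submod_ker.
move=> u [_ u0] ut; apply: coext_eq => // a.
apply: (inspan_sub (P := fun a : restr phi A^o => coext_fun u a = 0)) (ut) (tA a).
split=> [|r b c ub uc].
  by apply: (addIr (coext_fun u 0)); rewrite -coextD !add0r.
by rewrite coextD [X in X + _]funZ ub uc scaler0 addr0.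
Qed.
End Coextension.

(** * Approximations *)

Section Approximations.
Variable A : pzRingType.

Lemma linear_bijective (U V : lmodType A) (h : {linear U -> V}) :
  injective h -> surj h -> bijective h.
Proof. by move=> hi hs; have [k [hk kh]] := linear_inverse hi hs; exists k. Qed.

Lemma bijective_surj (U V : lmodType A) (h : {linear U -> V}) : bijective h -> surj h.
Proof. by move=> [k _ kh] y; exists (k y). Qed.

Lemma minimal_approximation_iso (X X' M : lmodType A) (p : {linear X -> M})
    (p' : {linear X' -> M}) (h : {linear X -> X'}) :
    bijective h -> (forall x, p' (h x) = p x) ->
  minimal_Pfin_approximation p -> minimal_Pfin_approximation p'.
Proof.
move=> bh ph [[PX liftX] minX]; have [hi hs] := (bij_inj bh, bijective_surj bh).
split; first split; first exact: Pfin_iso hi hs PX.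
  move=> Y f PY; have [g gf] := liftX Y f PY; exists (h \o g) => y.
  by rewrite /= ph.
move=> u pu; have [k [hk kh]] := linear_inverse hi hs.
have bu : bijective (k \o u \o h : {linear X -> X}).
  by apply: minX => x; rewrite /= -[p _]ph kh pu ph.
apply: (eq_bij (f := h \o (k \o u \o h) \o k)) => [|x].
  by apply: bij_comp; [apply: bij_comp|exists h].
by rewrite /= !kh.
Qed.

Lemma approximation_iso_target (X M N : lmodType A) (p : {linear X -> M})
    (h : {linear M -> N}) :
  injective h -> surj h -> Pfin_approximation p -> Pfin_approximation (h \o p).
Proof.
move=> hi hs [PX liftX]; split=> // Y f PY.
have [k [hk kh]] := linear_inverse hi hs.
by have [g gf] := liftX Y (k \o f) PY; exists g => y; rewrite /= gf /= kh.
Qed.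
End Approximations.

Section Main.
Variables (A : pzRingType) (e : A) (he : e * e = e).
Local Notation eAe := (corner he).
Local Notation cm M := (cornermod M he).
Hypotheses (aA : artin_algebra A) (bA : basic A).
Hypotheses (hS : finite_pdim (quotmod (jlideal (1 - e))))
  (hl : finite_pdim (cm (lideal (1 - e)))).

(** A map Y -> eF is transposed to Ae (x) Y -> F, lifted through p and restricted to corners. *)
Lemma approximation_corner (M F : lmodType A) (p : {linear M -> F}) :
  Pfin_approximation p -> Pfin_approximation (cornermap he p).
Proof.
move=> [PM liftM]; split; first exact: Pfin_corner.
move=> Y h PY; have [|g gh] := liftM _ (adjoint h); first exact: Pfin_tensor.
exists (cornermap he g \o tensor_unit Y) => y; apply: val_inj.
by rewrite [LHS]gh adjoint_unit.
Qed.

Lemma Pfin_coext (X : lmodType eAe) (F : lmodType A) (q : {linear X -> cm F}) :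
  Pfin X -> finitely_generated F -> Pfin (coext q).
Proof.
move=> PX fF; apply: (Pfin_of_corner (he := he)) => //.
  by apply: coext_fg => //; case: PX.
have [k [ek ke]] := linear_inverse (@coext_eval_inj _ _ _ _ _ q) (@coext_eval_surj _ _ _ _ _ q).
exact: Pfin_iso (can_inj ke) (bijective_surj (Bijective ke ek)) PX.
Qed.

Lemma approximation_coext (X : lmodType eAe) (F : lmodType A) (q : {linear X -> cm F}) :
  finitely_generated F -> Pfin_approximation q -> Pfin_approximation (coext_proj q).
Proof.
move=> fF [PX liftX]; split; first exact: Pfin_coext.
move=> Y h PY; have [|g gh] := liftX _ (cornermap he h); first exact: Pfin_corner.
by exists (coext_lift gh).
Qed.

(* An endomorphism of the coextension L of q over F is determined by its
   restriction to e L, that is, by an endomorphism of X over e F. *)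
Lemma minimal_coext (X : lmodType eAe) (F : lmodType A) (q : {linear X -> cm F})
    (u : {linear coext q -> coext q}) :
    (forall v : {linear X -> X}, (forall x, q (v x) = q x) -> bijective v) ->
    (forall z, coext_proj q (u z) = coext_proj q z) -> bijective u.
Proof.
move=> minq pu; have [k [ek ke]] :=
  linear_inverse (@coext_eval_inj _ _ _ _ _ q) (@coext_eval_surj _ _ _ _ _ q).
pose v : {linear X -> X} := coext_eval q \o cornermap he u \o k.
have qv x : q (v x) = q x.
  rewrite [LHS]coext_eval_compat -[x in RHS]ke coext_eval_compat.
  by apply: val_inj; exact: pu.
have bv := minq v qv.
have [w [vw wv]] := linear_inverse (bij_inj bv) (bijective_surj bv).
(* The inverse [w] of [v] is compatible with the maps to eF, so it lifts to an endomorphism over F.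
   By uniqueness of lifts this is the inverse of [u]. *)
have wq y : q ((w \o coext_eval q) y) = cornermap he (coext_proj q) y.
  by rewrite -coext_eval_compat -[RHS](congr1 q (wv _)) qv.
have ev y : coext_eval q (cornermap he u y) = v (coext_eval q y).
  by rewrite /v /= ek.
exists (coext_lift wq).
  apply: (coext_hom_ext (u := coext_lift wq \o u) (v := idfun)) => y; first exact: pu.
  rewrite -[LHS]/(coext_eval q (cornermap he (coext_lift wq) (cornermap he u y))).
  rewrite coext_eval_lift -[LHS]/(w (coext_eval q (cornermap he u y))) ev vw.
  by apply: congr1; apply: val_inj.
apply: (coext_hom_ext (u := u \o coext_lift wq) (v := idfun)) => y.
  by rewrite [LHS]pu.
rewrite -[LHS]/(coext_eval q (cornermap he u (cornermap he (coext_lift wq) y))).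
rewrite ev coext_eval_lift [LHS]wv.
by apply: congr1; apply: val_inj.
Qed.

(** Let L be the coextension of eM -> eF. The identity and u induce i : M -> L and U : L -> L over
    F, and p being an approximation gives g : L -> M. By minimality g i and g U i are bijective; on
    corners the second is the first composed with u. *)
Lemma minimal_corner (M F : lmodType A) (p : {linear M -> F}) :
    finitely_generated F -> minimal_Pfin_approximation p ->
  minimal_Pfin_approximation (cornermap he p).
Proof.
move=> fF [ap minp]; split; first exact: approximation_corner.
move=> u pu; set q := cornermap he p in u pu *.
have [PM liftM] := ap.
have PL : Pfin (coext q) by apply: Pfin_coext => //; exact: Pfin_corner.
have [g pg] := liftM _ (coext_proj q) PL.
have idq y : q (idfun y) = cornermap he p y by [].
have uq y : q ((u \o coext_eval q) y) = cornermap he (coext_proj q) y.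
  by rewrite -coext_eval_compat; exact: pu.
pose i := coext_lift idq; pose U := coext_lift uq.
have ba : bijective (g \o i : {linear M -> M}).
  by apply: minp => x; rewrite /= pg.
have bb : bijective (g \o U \o i : {linear M -> M}).
  by apply: minp => x; rewrite /= pg.
have Ui y : cornermap he U (cornermap he i y) = cornermap he i (u y).
  apply: (@coext_eval_inj _ _ _ _ _ q).
  rewrite [RHS](coext_eval_lift idq) [LHS](coext_eval_lift uq).
  exact: (congr1 u (coext_eval_lift idq y)).
have cbij (h : {linear M -> M}) : bijective h -> bijective (cornermap he h).
  move=> bh; apply: linear_bijective.
    exact/cornermap_inj/bij_inj.
  exact/cornermap_surj/bijective_surj.
have [a' aK Ka] := cbij _ ba; have bb' := cbij _ bb.
apply: (eq_bij (f := a' \o cornermap he (g \o U \o i))) => [|y /=].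
  by apply: bij_comp => //; exists (cornermap he (g \o i)).
rewrite -[RHS]aK; congr a'; apply: val_inj => /=.
exact: (congr1 (fun z => g (val z)) (Ui y)).
Qed.

(** * Eligible extensions and the coextension as their maximum *)

Section Extensions.
Variables (F : lmodType A) (hF : torsionfree e F).
Variables (X : lmodType eAe) (q : {linear X -> cm F}).
Local Notation f := (induced_map hF q).
Local Notation M0 := (quotmod (Delta e (tensor X))).
Local Notation eligible := (eligible e f).

Lemma induced_mapE t : f (quotpi _ t) = adjoint q t.
Proof.
rewrite -[LHS]/(Deltalift (tensor_eps he F) hF (Deltamap e (tensor_map q) (quotpi _ t))).
by rewrite [Deltamap _ _ _]quotlift_pi; exact: quotlift_pi.
Qed.

Lemma torsionfree_quot (M : lmodType A) : torsionfree e (quotmod (Delta e M)).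
Proof.
move=> y; have [x <-] := quotpi_surj y => /asboolP x0; apply/quotpi_eq0/asboolP => a.
have := x0 a; rewrite -linearZ => /quotpi_eq0/asboolP/(_ 1).
by rewrite mulr1 scalerA mulrA he.
Qed.

(** Dividing out Delta does not affect the corner, because Delta is killed by e; so X is also the
    corner of the torsion-free quotient. *)
Definition M0_unit : {linear X -> cm M0} :=
  cornermap he (quotpi (Delta e (tensor X))) \o tensor_unit X.

Lemma M0_unit_inj : injective M0_unit.
Proof.
apply: lin_inj => x /(congr1 val)/quotpi_eq0/asboolP/(_ 1).
rewrite mulr1 [LHS]cornermodP => x0; apply: (@tensor_unit_inj _ _ he X).
by rewrite linear0; apply: val_inj.
Qed.

Lemma M0_unit_surj : surj M0_unit.
Proof.
move=> y; have [z <-] := cornermap_surj (he := he) (@quotpi_surj _ _ (Delta e (tensor X))) y.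
by have [x <-] := tensor_unit_surj z; exists x.
Qed.

Section Eligible.
Variable p : eligible.
Local Notation i := (elig_incl p).

Lemma elig_corner (y : elig_mod p) : exists m, i m = e *: y.
Proof.
have := elig_torsion (quotpi (lrange i) y); rewrite -linearZ.
by move=> /quotpi_eq0/asboolP.
Qed.

(** As L/M is killed by e, the corner of L is that of M, hence X. *)
Definition elig_unit : {linear X -> cm (elig_mod p)} := cornermap he i \o M0_unit.

Lemma elig_unit_inj : injective elig_unit.
Proof.
by move=> x y /(cornermap_inj (@elig_incl_inj _ _ _ _ _ p)) /M0_unit_inj.
Qed.

Lemma elig_unit_surj : surj elig_unit.
Proof.
move=> y; have [m im] := elig_corner (val y).
have [x xm] := M0_unit_surj (corner_proj he m).
exists x; rewrite -[LHS]/(cornermap he i (M0_unit x)) xm; apply: val_inj.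
rewrite -[LHS]/(i (e *: m)) linearZ im.
exact: etrans (corner_idem he _) (cornermodP y).
Qed.

Lemma elig_unit_compat x : cornermap he (elig_map p) (elig_unit x) = q x.
Proof.
apply: val_inj; rewrite [LHS]elig_compat.
by rewrite [LHS]induced_mapE adjoint_unit.
Qed.

(** Delta(L) meets the image of M in Delta(M) = 0, so it vanishes by essentiality. *)
Lemma elig_torsionfree : torsionfree e (elig_mod p).
Proof.
move=> y; apply: elig_essential => {}y /asboolP y0 /asboolP[m im].
rewrite -im (_ : m = 0) ?linear0//; apply: torsionfree_quot; apply/asboolP => a.
by apply: (@elig_incl_inj _ _ _ _ _ p); rewrite linear0 linearZ im; exact: y0.
Qed.

Lemma elig_embed : exists psi : {linear elig_mod p -> coext q},
  injective psi /\ forall z, coext_proj q (psi z) = elig_map p z.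
Proof.
have [g [ug gu]] := linear_inverse elig_unit_inj elig_unit_surj.
have gq y : q (g y) = cornermap he (elig_map p) y.
  by rewrite -elig_unit_compat gu.
exists (coext_lift gq); split=> //.
by apply: coext_lift_inj; [exact: can_inj gu|exact: elig_torsionfree].
Qed.
End Eligible.

(** The torsion-free quotient of Ae (x) X embeds by the universal property. Both corners are X, so
    the cokernel is killed by e. A nonzero x in the coextension has some e a x nonzero, and this
    element lies in the image: the extension is essential. *)
Lemma coext_eligible : exists p : eligible,
  exists psi : {linear elig_mod p -> coext q},
    bijective psi /\ forall z, coext_proj q (psi z) = elig_map p z.
Proof.
have [g [ug gu]] := linear_inverse M0_unit_inj M0_unit_surj.
have gq y : q (g y) = cornermap he f y.
  by rewrite -[y in RHS]gu; apply: val_inj; rewrite [RHS]induced_mapE adjoint_unit.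
pose i := coext_lift gq.
have ii : injective i.
  by apply: coext_lift_inj; [exact: can_inj gu|exact: torsionfree_quot].
have ei (z : coext q) : e *: z \in lrange i.
  apply/asboolP; pose m := M0_unit (coext_eval q (corner_proj he z)).
  suff /(congr1 val) iz : cornermap he i m = corner_proj he z by exists (val m).
  by apply: (@coext_eval_inj _ _ _ _ _ q); rewrite coext_eval_lift ug.
have ess : essential i.
  move=> N Ni x xN; apply: (coext_torsionfree hF); apply/asboolP => a.
  rewrite -scalerA; apply: Ni => //.
  by apply: rpredZ; apply: rpredZ.
have tors : torsion e (quotmod (lrange i)).
  by move=> y; have [z <-] := quotpi_surj y; rewrite -linearZ; exact/quotpi_eq0.
exists (Eligible (elig_incl := i) (elig_map := coext_proj q) ii ess tors
  (coext_proj_lift gq)).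
by exists idfun; split=> //; exists idfun.
Qed.

Lemma elig_iso_refl (p : eligible) : elig_iso p p.
Proof. by exists idfun; split=> //; exists idfun. Qed.

Lemma elig_iso_sym (p r : eligible) : elig_iso p r -> elig_iso r p.
Proof.
move=> [h [bh hE]].
have [k [hk kh]] := linear_inverse (bij_inj bh) (bijective_surj bh).
by exists k; split=> [|x]; [exists h|rewrite -hE kh].
Qed.

Lemma elig_iso_trans (p r s : eligible) : elig_iso p r -> elig_iso r s -> elig_iso p s.
Proof.
move=> [h [bh hE]] [k [bk kE]]; exists (k \o h); split=> [|x].
  exact: bij_comp.
by rewrite /= kE hE.
Qed.

Lemma elig_class_eq (p r : eligible) : elig_iso p r -> elig_class p = elig_class r.
Proof.
move=> pr; apply/funext => s; apply/propext; split; last exact: elig_iso_trans.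
exact/elig_iso_trans/elig_iso_sym.
Qed.

Lemma Dext_eq (C D : Dext e f) : (C : eligible -> Prop) = D -> C = D.
Proof.
case: C D => [C hC] [D hD] /= CD; subst D; congr DextClass.
exact: Prop_irrelevance.
Qed.

Hypothesis minq : minimal_Pfin_approximation q.

(** Every pair embeds in the coextension L by [elig_embed]. For a pair above L, the round trip from
    L through it is an endomorphism of L over F, bijective by minimality of q, so the embedding back
    into L is onto. *)
Lemma Dext_maximum : exists pm : eligible,
  [/\ exists psi : {linear elig_mod pm -> coext q},
        bijective psi /\ forall z, coext_proj q (psi z) = elig_map pm z,
      forall p, elig_le p pm
    & forall p, elig_le pm p -> elig_iso pm p].
Proof.
have [pm [psi [bpsi psiE]]] := coext_eligible.
have [k [pk kp]] := linear_inverse (bij_inj bpsi) (bijective_surj bpsi).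
exists pm; split=> [|p|p [chi [ichi chiE]]]; first by exists psi.
  have [h [hi hE]] := elig_embed p.
  exists (k \o h); split=> [x y /(can_inj kp)/hi//|x].
  by rewrite /= -psiE kp hE.
have [h [hi hE]] := elig_embed p.
have b : bijective (h \o chi \o k : {linear coext q -> coext q}).
  apply: minimal_coext => [|z /=]; first by case: minq.
  by rewrite [LHS]hE chiE -psiE kp.
have hs : surj h.
  by move=> y; have [x <-] := bijective_surj b y; exists (chi (k x)).
have [j [hj jh]] := linear_inverse hi hs.
exists (j \o psi); split=> [|x]; first by apply: bij_comp => //; exists h.
by rewrite /= -hE jh psiE.
Qed.

Lemma Dext_unique_maximal : finitely_generated F ->
  (exists! C : Dext e f, Dext_maximal C) /\
  forall C : Dext e f, Dext_maximal C ->
  forall p : eligible, C p -> minimal_Pfin_approximation (elig_map p).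
Proof.
move=> fF; have [pm [[psi [bpsi psiE]] le_pm max_pm]] := Dext_maximum.
pose Cm : Dext e f := DextClass (ex_intro _ pm erefl).
(* The class of [pm] lies above every class, so a maximal class must equal it. *)
have maxC C : Dext_maximal C -> Cm = C.
  case: C => C [r Cr] maxC; apply: maxC; exists r, pm; split=> //.
    by rewrite /= Cr; exact: elig_iso_refl.
  exact: elig_iso_refl.
split.
  (* The order on classes only provides some representatives [p] and [s]; composing with an
     isomorphism from [pm] to [p] brings [max_pm] into play. *)
  exists Cm; split=> // [[C [r Cr]]] [p [s [pm_p Cs [h [hi hE]]]]].
  have [k [bk kE]] := pm_p; apply: Dext_eq; rewrite /= Cr; apply: elig_class_eq.
  have rs : elig_iso r s by move: Cs; rewrite /= Cr.
  apply: elig_iso_trans rs _; apply: elig_iso_sym; apply: max_pm.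
  exists (h \o k); split=> [x y /hi/(bij_inj bk)//|x].
  by rewrite /= hE kE.
move=> C /maxC <- p [h [bh hE]].
have [k [pk kp]] := linear_inverse (bij_inj bpsi) (bijective_surj bpsi).
apply: (minimal_approximation_iso (p := coext_proj q) (h := h \o k)) => [|x|].
- by apply: bij_comp => //; exists psi.
- by rewrite /= hE -psiE kp.
split; first by apply: approximation_coext => //; case: minq.
by move=> u; apply: minimal_coext; case: minq.
Qed.
End Extensions.
End Main.

Unset Implicit Arguments.

Theorem theorem4p6 (Lambda : pzRingType) (hA : artin_algebra Lambda)
    (hb : basic Lambda) (e : Lambda) (he : e * e = e)
    (h1 : finite_pdim (quotmod (jlideal (1 - e))))
    (h2 : finite_pdim (cornermod (lideal (1 - e)) he)) :
  (Pfin_contravariantly_finite Lambda <->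
   Pfin_contravariantly_finite (corner he)) /\
  forall (F : lmodType Lambda) (hfg : finitely_generated F)
         (hF : torsionfree e F),
    (forall (M : lmodType Lambda) (p : {linear M -> F}),
        minimal_Pfin_approximation p ->
        minimal_Pfin_approximation (cornermap he p)) /\
    (forall (X : lmodType (corner he)) (q : {linear X -> cornermod F he}),
        minimal_Pfin_approximation q ->
        (exists! C : Dext e (induced_map hF q), Dext_maximal C) /\
        forall C : Dext e (induced_map hF q), Dext_maximal C ->
        forall p : eligible e (induced_map hF q), C p ->
          minimal_Pfin_approximation (elig_map p)).
Proof.
split; last first.
  move=> F fF hF; split=> [M p|X q minq]; first exact: minimal_corner.
  exact: Dext_unique_maximal.
split=> [cfA N fN|cfC F fF].
  (* A module N over the corner is e(Ae (x) N): the corner of an approximation of Ae (x) N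
     approximates N. *)
  have [M [p ap]] := cfA _ (fg_tensor fN).
  have [j [uj ju]] := linear_inverse (@tensor_unit_inj _ _ he N) (@tensor_unit_surj _ _ he N).
  exists (cornermod M he), (j \o cornermap he p).
  apply: approximation_iso_target (can_inj ju) (bijective_surj (Bijective ju uj)) _.
  exact: approximation_corner.
(* Conversely, the coextension of an approximation of eF approximates F. *)
have [X [q aq]] := cfC _ (fg_corner he hA fF).
by exists (coext q), (coext_proj q); exact: approximation_coext.
Qed.
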